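(* If the family $\{f_t\}_t$ is Newton-admissible, then it has a uniform stable radius: there exist $\tau>0$ and $r>0$ such that for every pair $(\varepsilon,\varepsilon')$ with $0<\varepsilon'\le\varepsilon\le r$ there exists $\delta(\varepsilon,\varepsilon')>0$ such that for every $\eta\in\mathbb{C}$ with $0<|\eta|\le\delta(\varepsilon,\varepsilon')$ and every $t$ with $|t|\le\tau$, the hypersurface $V(f_t-\eta)=\{\mathbf z: f_t(\mathbf z)=\eta\}$ is non-singular in the open ball $\mathring{B}_r\subseteq\mathbb{C}^n$ and intersects the sphere $\mathbb{S}_{\varepsilon''}$ transversely for every $\varepsilon''\in[\varepsilon',\varepsilon]$ (balls and spheres centred at the origin of $\mathbb{C}^n$).
   Context: Let $(t,\mathbf{z})=(t,z_1,\ldots,z_n)$ be coordinates on $\mathbb{C}\times\mathbb{C}^n$. For $k\in K_0:=\{1,\ldots,k_0\}$ let $f^k\colon\mathbb{C}\times\mathbb{C}^n\to\mathbb{C}$ be a non-constant polynomial with $f^k(t,\mathbf{0})=0$ for all $t$; put $f:=f^1\cdots f^{k_0}$, $f_t(\mathbf{z}):=f(t,\mathbf{z})$, $f^k_t(\mathbf{z}):=f^k(t,\mathbf{z})$. All statements concern germs at the origin. Newton data: for a polynomial $g(\mathbf{z})=\sum_\alpha c_\alpha\mathbf{z}^\alpha$ with $g(\mathbf{0})=0$, $\Gamma_+(g)$ is the convex hull in $\mathbb{R}^n_+$ of $\bigcup_{c_\alpha\neq0}(\alpha+\mathbb{R}^n_+)$, and the Newton boundary $\Gamma(g)$ is the union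 of its compact faces. For a weight vector $\mathbf{w}=(w_1,\ldots,w_n)\in\mathbb{N}^n\setminus\{\mathbf{0}\}$ (nonnegative integers), $d(\mathbf{w};g):=\min\{\sum_i w_ix_i : x\in\Gamma_+(g)\}$, $\Delta(\mathbf{w};g)$ is the face of $\Gamma_+(g)$ where this minimum is attained, $g_{\mathbf{w}}:=\sum_{\alpha\in\Delta(\mathbf{w};g)}c_\alpha\mathbf{z}^\alpha$ is the face function, and $I(\mathbf{w}):=\{i: w_i=0\}$. $\mathbf w$ is positive if all $w_i>0$. For $I\subseteq\{1,\ldots,n\}$, $\mathbb{C}^I:=\{\mathbf{z}: z_i=0 \text{ for } i\notin I\}$ and $\mathbb{C}^{*I}:=\{\mathbf{z}: z_i=0\iff i\notin I\}$; $\mathbb{C}^{*n}=\mathbb{C}^{*\{1,\ldots,n\}}$. $\mathcal{V}_g$ is the set of $I$ with $g|_{\mathbb{C}^I}\equiv0$. For $i_1,\ldots,i_m$ and $u_{i_j}\in\mathbb{C}^*$, $\mathbb{C}^{*n}(u_{i_1},\ldots,u_{i_m}):=\{\mathbf{z}\in\mathbb{C}^{*n}: z_{i_j}=u_{i_j},\ 1\le j\le m\}$. Non-degenerate complete intersection: polynomials $g^1,\ldots,g^p$ vanishing at $\mathbf 0$ define a non-degenerate complete intersection germ $V(g^1,\ldots,g^p)$ if for every positive weight vector $\mathbf{w}$, the $p$-form $dg^1_{\mathbf{w}}\wedge\cdots\wedge dg^p_{\mathbf{w}}$ is nowhere zero on $V^*(g^1_{\mathbf{w}},\ldots,g^p_{\mathbf{w}}):=\{\mathbf{z}\in\mathbb{C}^{*n}: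 g^1_{\mathbf{w}}(\mathbf{z})=\cdots=g^p_{\mathbf{w}}(\mathbf{z})=0\}$. Local tameness: $R>0$ is a radius of local tameness of $\{g^1,\ldots,g^p\}$ if for every nonempty $I=\{i_1,\ldots,i_m\}\in\mathcal{V}_{g^1}\cap\cdots\cap\mathcal{V}_{g^p}$, every $\mathbf{w}\in\mathbb{N}^n\setminus\{\mathbf 0\}$ with $I(\mathbf{w})=I$ and every $u_{i_1},\ldots,u_{i_m}\in\mathbb{C}^*$ with $\sum_j|u_{i_j}|^2<R$, the set $V^*(g^1_{\mathbf{w}},\ldots,g^p_{\mathbf{w}})\cap\mathbb{C}^{*n}(u_{i_1},\ldots,u_{i_m})$ is a reduced non-singular complete intersection in $\mathbb{C}^{*n}(u_{i_1},\ldots,u_{i_m})$, i.e. the differentials of $g^1_{\mathbf{w}},\ldots,g^p_{\mathbf{w}}$ with respect to the variables $(z_i)_{i\notin I}$ are linearly independent at each of its points; the germ is locally tame if such $R$ exists. Newton-admissible: $\{f_t\}_t$ is Newton-admissible if there is $R>0$ such that for all sufficiently small $t$: (i) for each $k\in K_0$, $\Gamma(f^k_t)$ is independent of $t$; (ii) for every nonempty $\{k_1,\ldots,k_p\}\subseteq K_0$, $V(f^{k_1}_t,\ldots,f^{k_p}_t)$ is a non-degenerate, locally tame complete intersection germ having a radius of local tameness greater than $R$ ($R$ independent of $t$ and of the subset). *)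

(* Defs.v *)
From mathcomp Require Import all_boot all_order all_algebra.
From mathcomp Require Import reals.
From mathcomp Require Import complex.
From mathcomp Require Import mpoly.
From Stdlib Require Import ClassicalEpsilon.
Import Order.TTheory GRing.Theory Num.Theory.

Set Implicit Arguments.
Unset Strict Implicit.
Unset Printing Implicit Defensive.

Local Open Scope ring_scope.

Section NewtonAdmissible.
Variable R : realType.
Local Notation C := (R[i]).

Definition pdec (P : Prop) : bool :=
  if excluded_middle_informative P then true else false.

Section Dim.
Variable n : nat.

(* Specialisation t |-> f_t of a polynomial f in (t, z), represented as a
   polynomial in z = (z_1..z_n) whose coefficients are polynomials in t. *)
Definition fspec (F : {mpoly {poly C}[n]}) (t : C) : {mpoly C[n]} :=
  map_mpoly (horner_eval t) F.

Definition grad (g : {mpoly C[n]}) (z : 'I_n -> C) : 'I_n -> C :=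
  fun i => (mderiv i g).@[z].

Definition normv (z : 'I_n -> C) : R := Num.sqrt (\sum_i Normc.normc (z i) ^+ 2).

Definition expvec (m : 'X_{1..n}) : 'I_n -> R := fun i => (m i)%:R.

Definition dotR (u x : 'I_n -> R) : R := \sum_i u i * x i.

Definition conv_hull (S : ('I_n -> R) -> Prop) (x : 'I_n -> R) : Prop :=
  exists (k : nat) (p : 'I_k -> 'I_n -> R) (mu : 'I_k -> R),
    [/\ forall j, S (p j), forall j, 0 <= mu j, \sum_j mu j = 1
      & forall i, x i = \sum_j mu j * p j i].

Definition Gamma_plus (g : {mpoly C[n]}) : ('I_n -> R) -> Prop :=
  conv_hull (fun y => exists2 m, m \in msupp g & forall i, expvec m i <= y i).

(* The (possibly empty) face of Gamma_+(g) on which the linear form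
   x |-> <u, x> attains its minimum over Gamma_+(g). *)
Definition face_dir (u : 'I_n -> R) (g : {mpoly C[n]}) (x : 'I_n -> R) : Prop :=
  Gamma_plus g x /\ forall y, Gamma_plus g y -> dotR u x <= dotR u y.

Definition Delta (w : 'I_n -> nat) (g : {mpoly C[n]}) : ('I_n -> R) -> Prop :=
  face_dir (fun i => (w i)%:R) g.

Definition face_fn (w : 'I_n -> nat) (g : {mpoly C[n]}) : {mpoly C[n]} :=
  \sum_(m <- msupp g | pdec (Delta w g (expvec m))) g@_m *: 'X_[m].

Definition bounded_set (F : ('I_n -> R) -> Prop) : Prop :=
  exists M : R, forall x, F x -> forall i, `|x i| <= M.

(* Newton boundary Gamma(g): union of the compact faces of Gamma_+(g).
   Faces are the sets where a linear form attains its minimum on Gamma_+(g);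
   they are closed, so compact = bounded. *)
Definition newton_boundary (g : {mpoly C[n]}) (x : 'I_n -> R) : Prop :=
  exists u : 'I_n -> R, bounded_set (face_dir u g) /\ face_dir u g x.

Definition lin_indep (k0 : nat) (S : {set 'I_k0}) (J : pred 'I_n)
    (v : 'I_k0 -> 'I_n -> C) : Prop :=
  forall c : 'I_k0 -> C,
    (forall i, J i -> \sum_(k in S) c k * v k i = 0) ->
    forall k, k \in S -> c k = 0.

Definition nondegenerate (k0 : nat) (S : {set 'I_k0})
    (G : 'I_k0 -> {mpoly C[n]}) : Prop :=
  forall w : 'I_n -> nat, (forall i, 0 < w i)%N ->
  forall z : 'I_n -> C, (forall i, z i != 0) ->
    (forall k, k \in S -> (face_fn w (G k)).@[z] = 0) ->
    lin_indep S predT (fun k => grad (face_fn w (G k)) z).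

Definition vanishes_on_coord (g : {mpoly C[n]}) (I : {set 'I_n}) : Prop :=
  forall z : 'I_n -> C, (forall i, i \notin I -> z i = 0) -> g.@[z] = 0.

Definition tame_radius (k0 : nat) (S : {set 'I_k0})
    (G : 'I_k0 -> {mpoly C[n]}) (Rad : R) : Prop :=
  forall I : {set 'I_n}, I != set0 ->
  (forall k, k \in S -> vanishes_on_coord (G k) I) ->
  forall w : 'I_n -> nat, (exists i, w i != 0%N) ->
  (forall i, (w i == 0%N) = (i \in I)) ->
  forall u : 'I_n -> C, (forall i, i \in I -> u i != 0) ->
  \sum_(i in I) Normc.normc (u i) ^+ 2 < Rad ->
  forall z : 'I_n -> C, (forall i, z i != 0) -> (forall i, i \in I -> z i = u i) ->
    (forall k, k \in S -> (face_fn w (G k)).@[z] = 0) ->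
    lin_indep S (fun i => i \notin I) (fun k => grad (face_fn w (G k)) z).

Definition newton_admissible (k0 : nat) (F : 'I_k0 -> {mpoly {poly C}[n]}) : Prop :=
  exists2 R0 : R, 0 < R0 & exists2 tau0 : R, 0 < tau0 &
    (forall k t t', Normc.normc t < tau0 -> Normc.normc t' < tau0 ->
       forall x, newton_boundary (fspec (F k) t) x <->
                 newton_boundary (fspec (F k) t') x) /\
    (forall t, Normc.normc t < tau0 -> forall S : {set 'I_k0}, S != set0 ->
       nondegenerate S (fun k => fspec (F k) t) /\
       exists2 Rad : R, R0 < Rad & tame_radius S (fun k => fspec (F k) t) Rad).

Definition nonsingular_in_ball (g : {mpoly C[n]}) (r : R) : Prop :=
  forall z, normv z < r -> g.@[z] = 0 -> exists i, grad g z i != 0.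

(* V(g) is a smooth hypersurface at z and meets the sphere through z
   transversely there: T_z V(g) + T_z S = C^n as real vector spaces, with
   T_z V(g) = ker dg(z) and T_z S = { v | Re <v, z> = 0 }. *)
Definition transverse_sphere_at (g : {mpoly C[n]}) (z : 'I_n -> C) : Prop :=
  (exists i, grad g z i != 0) /\
  forall v : 'I_n -> C, exists a b : 'I_n -> C,
    [/\ forall i, v i = a i + b i,
        \sum_i grad g z i * a i = 0
      & complex.Re (\sum_i b i * conjc (z i)) = 0].

Definition transverse_to_sphere (g : {mpoly C[n]}) (e : R) : Prop :=
  forall z, normv z = e -> g.@[z] = 0 -> transverse_sphere_at g z.

End Dim.
End NewtonAdmissible.

(* Main.v *)
Require Import Defs.
From mathcomp Require Import all_boot all_order all_algebra.
From mathcomp Require Import reals.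
From mathcomp Require Import complex.
From mathcomp Require Import mpoly.
From mathcomp Require filter exp.
From mathcomp Require Import lra ring.
From Stdlib Require Import Classical ClassicalEpsilon.
Import Order.TTheory GRing.Theory Num.Theory.
Local Open Scope ring_scope.

(* A sequence of points violating the conclusion is analysed along a
   nonprincipal ultrafilter, which plays the role of the curve selection lemma:
   the finitely many Laurent monomials in play each tend to 0, to infinity or
   to a nonzero limit, and linear algebra over the rationals produces an
   integral weight vector [w] and a point [a] of the torus governing all of
   them, so that f^k behaves as the value at [a] of its face function for [w].
   Limits of the critical-point relation, normalised by the size of its
   coefficients, are linear relations between the differentials of face
   functions at [a].  Euler's identity sum_i w_i a_i d_i g_w = d(w) g_w shows
   that only those k for which the face function vanishes at [a] contribute;
   then nondegeneracy (near the origin) or local tameness (for the directions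
   normal to a coordinate stratum) forbids the relation, except for relations
   tangential to the stratum, which are excluded by transversality of the
   smaller strata to small spheres, itself proved in the same way. *)

Set Implicit Arguments.
Unset Strict Implicit.
Unset Printing Implicit Defensive.

(** * Limits along an ultrafilter *)

(** An ultrafilter settles every alternative along one fixed sequence, so no subsequence is ever
    extracted. Derivatives enter only as [z_i d_i], which maps each monomial to a multiple of
    itself; values and gradients are thus governed by the same weight vector. The product [f] is
    treated by logarithmic differentiation: a relation on [df] becomes one on the [df^k] with
    coefficients [c_k = lam f / f^k]. All the [c_k f^k] coincide, so their normalised limits are one
    number [e], and Euler's identity becomes an equation for [e] alone. Once [e = 0], a face
    function with nonzero limit coefficient has to vanish at [a]. Uniformity in [t] means that the
    parameters merely converge to some [t0], where coefficients may disappear; constancy of the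
    Newton boundary ensures that the face functions at [t0] still carry the leading terms. Local
    tameness speaks only of those [f^k] that vanish identically on the stratum of the limit point;
    the remaining ones are the source of the tangential relations. *)

Record nat_ultrafilter (U : (nat -> Prop) -> Prop) : Prop := NatUltrafilter {
  ultra_mono : forall P Q : nat -> Prop, (forall m, P m -> Q m) -> U P -> U Q;
  ultra_and : forall P Q, U P -> U Q -> U (fun m => P m /\ Q m);
  ultra_total : forall P, U P \/ U (fun m => ~ P m);
  ultra_ex : forall P, U P -> exists m, P m;
  ultra_tail : forall N, U (fun m => (N <= m)%N) }.

Lemma nat_ultrafilter_exists : exists U, nat_ultrafilter U.
Proof.
have [G [GU sub]] := filter.ultraFilterLemma filter.eventually_filter.
have PG := @filter.ultra_proper _ _ GU.
exists G; split.
- by move=> P Q PQ GP; apply: filter.filterS GP.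
- by move=> P Q; apply: filter.filterI.
- by move=> P; have [] := filter.in_ultra_setVsetC P GU; [left | right].
- by move=> P /filter.filter_ex.
- by move=> N; apply: sub; exists N.
Qed.

Section Ultralimits.
Variables (R : realType) (U : (nat -> Prop) -> Prop).
Hypothesis HU : nat_ultrafilter U.
Local Notation C := (R[i]).
Local Notation nm := (@Normc.normc R).

Lemma nmD (x y : C) : nm (x + y) <= nm x + nm y.
Proof. exact: (@le_normcD R). Qed.
Lemma nmN (x : C) : nm (- x) = nm x.
Proof. exact: (@normcN R). Qed.
Lemma nmM (x y : C) : nm (x * y) = nm x * nm y.
Proof. exact: Normc.normcM. Qed.
Lemma nmV (x : C) : nm x^-1 = (nm x)^-1.
Proof. exact: Normc.normcV. Qed.
Lemma nm_ge0 (x : C) : 0 <= nm x.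
Proof. by case: x => a b; apply: sqrtr_ge0. Qed.
Lemma nm_eq0 (x : C) : (nm x == 0) = (x == 0).
Proof.
by apply/eqP/eqP => [/Normc.eq0_normc|->] //; rewrite Normc.normc0.
Qed.
Lemma nm_gt0 (x : C) : (0 < nm x) = (x != 0).
Proof. by rewrite lt_def nm_ge0 andbT nm_eq0. Qed.
Lemma nm_real (x : R) : nm x%:C%C = `|x|.
Proof. by rewrite /= expr0n addr0 sqrtr_sqr. Qed.
Lemma nm_prod (I : Type) (s : seq I) (P : pred I) (F : I -> C) :
  nm (\prod_(i <- s | P i) F i) = \prod_(i <- s | P i) nm (F i).
Proof.
by apply: (big_morph nm); [exact: nmM | exact: Normc.normc1].
Qed.
Lemma nmX (x : C) k : nm (x ^+ k) = nm x ^+ k.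
Proof.
elim: k => [|k IH]; first by rewrite !expr0 (Normc.normc1 R).
by rewrite !exprS nmM IH.
Qed.
Lemma nm_dist (x y : C) : `|nm x - nm y| <= nm (x - y).
Proof.
have h1 := nmD (x - y) y; have h2 := nmD (y - x) x.
rewrite !subrK in h1 h2.
have h3 : nm (y - x) = nm (x - y) by rewrite -nmN opprB.
rewrite ler_norml; apply/andP; split; lra.
Qed.
Lemma nm_le_ReIm (x : C) : nm x <= `|complex.Re x| + `|complex.Im x|.
Proof.
case: x => a b /=; have ha := normr_ge0 a; have hb := normr_ge0 b.
rewrite -[leRHS]ger0_norm ?addr_ge0 // -sqrtr_sqr ler_wsqrtr //.
by rewrite sqrrD !real_normK ?num_real // addrAC lerDl mulrn_wge0 // mulr_ge0.
Qed.
Lemma Re_le_nm (x : C) : `|complex.Re x| <= nm x.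
Proof. by case: x => a b /=; rewrite -sqrtr_sqr ler_wsqrtr // lerDl sqr_ge0. Qed.
Lemma Im_le_nm (x : C) : `|complex.Im x| <= nm x.
Proof. by case: x => a b /=; rewrite -sqrtr_sqr ler_wsqrtr // lerDr sqr_ge0. Qed.

Lemma ultraW (P : nat -> Prop) : (forall m, P m) -> U P.
Proof. by move=> h; apply: (ultra_mono HU) (ultra_tail HU 0). Qed.

Lemma ultra_forall_seq (T : eqType) (s : seq T) (P : T -> nat -> Prop) :
  (forall i, i \in s -> U (P i)) -> U (fun m => forall i, i \in s -> P i m).
Proof.
elim: s => [|i s IH] h; first exact: ultraW.
have hs : U (fun m => forall j, j \in s -> P j m).
  by apply: IH => j js; apply: h; rewrite inE js orbT.
have hi := h i (mem_head _ _).
apply: (ultra_mono HU) (ultra_and HU hi hs) => m [h1 h2] j.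
by rewrite inE => /orP[/eqP->|/h2].
Qed.

Lemma ultra_forall (T : finType) (P : T -> nat -> Prop) :
  (forall i, U (P i)) -> U (fun m => forall i, P i m).
Proof.
move=> h; apply: (ultra_mono HU) (@ultra_forall_seq _ (enum T) P _) => //.
by move=> m hm i; apply: hm; rewrite mem_enum.
Qed.

(** Otherwise every [P i] would fail almost everywhere, hence all of them at once. This freezes
    discrete data along a sequence, such as the set of nonzero coordinates. *)
Lemma ultra_pick (T : finType) (P : T -> nat -> Prop) :
  U (fun m => exists i, P i m) -> exists i, U (P i).
Proof.
move=> h; apply: NNPP => no.
have h2 : U (fun m => forall i, ~ P i m).
  apply: ultra_forall => i; case: (ultra_total HU (P i)) => // hi.
  by case: no; exists i.
by have [m [[i hi] /(_ i)]] := ultra_ex HU (ultra_and HU h h2).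
Qed.

Lemma ultra_invS_lt (e : R) : 0 < e -> U (fun m => m.+1%:R^-1 < e).
Proof.
move=> e0; apply: (ultra_mono HU) (ultra_tail HU (Num.bound e^-1)) => m hm.
rewrite invf_plt ?posrE ?ltr0n //.
apply: (lt_le_trans (archi_boundP _)); first by rewrite invr_ge0 ltW.
by rewrite ler_nat leqW.
Qed.

Definition tends (x : nat -> C) (l : C) :=
  forall e : R, 0 < e -> U (fun m => nm (x m - l) < e).

Lemma tends_cst (l : C) : tends (fun=> l) l.
Proof. by move=> e e0; apply: ultraW => m; rewrite subrr Normc.normc0. Qed.

Lemma small_tends0 (x : nat -> C) : (forall m, nm (x m) <= m.+1%:R^-1) -> tends x 0.
Proof.
move=> hx e e0; apply: (ultra_mono HU) (ultra_invS_lt e0) => m h.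
by rewrite subr0; apply: le_lt_trans h.
Qed.

Lemma tends_eq (x y : nat -> C) l : U (fun m => x m = y m) -> tends x l -> tends y l.
Proof.
by move=> h hx e /hx he; apply: (ultra_mono HU) (ultra_and HU h he) => m [->].
Qed.

Lemma tends_ext (x y : nat -> C) l : x =1 y -> tends x l -> tends y l.
Proof. by move=> h; apply: tends_eq; apply: ultraW. Qed.

Lemma tends_uniq x l l' : tends x l -> tends x l' -> l = l'.
Proof.
move=> h h'; apply/eqP; rewrite -subr_eq0 -nm_eq0; apply/eqP/le_anti.
rewrite nm_ge0 andbT leNgt; apply/negP => d0.
have d2 : 0 < nm (l - l') / 2 by lra.
have [m []] := ultra_ex HU (ultra_and HU (h _ d2) (h' _ d2)).
have := nmD (l - x m) (x m - l'); rewrite subrKA.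
have -> : nm (l - x m) = nm (x m - l) by rewrite -nmN opprB.
move=> *; lra.
Qed.

Lemma tendsD x y l l' : tends x l -> tends y l' -> tends (fun m => x m + y m) (l + l').
Proof.
move=> h h' e e0; have d2 : 0 < e / 2 by lra.
apply: (ultra_mono HU) (ultra_and HU (h _ d2) (h' _ d2)) => m [].
have := nmD (x m - l) (y m - l').
have -> : x m - l + (y m - l') = x m + y m - (l + l') by ring.
move=> *; lra.
Qed.

Lemma tends_nm_bound x l : tends x l -> U (fun m => nm (x m) <= nm l + 1).
Proof.
move=> /(_ 1 ltr01); apply: (ultra_mono HU) => m.
have := nmD (x m - l) l; rewrite subrK => *; lra.
Qed.

Lemma tends_bound0 x y B : U (fun m => nm (x m) <= B) -> tends y 0 ->
  tends (fun m => x m * y m) 0.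
Proof.
move=> hB hy e e0.
have B0 : 0 < `|B| + 1 by have := normr_ge0 B; lra.
have d : 0 < e / (`|B| + 1) by apply: divr_gt0.
apply: (ultra_mono HU) (ultra_and HU hB (hy _ d)) => m [h1].
rewrite !subr0 nmM ltr_pdivlMr // => h2.
apply: le_lt_trans h2; rewrite mulrC ler_wpM2l ?nm_ge0 //.
by have := ler_norm B; lra.
Qed.

Lemma tendsZ k x l : tends x l -> tends (fun m => k * x m) (k * l).
Proof.
move=> h.
have h0 : tends (fun m => x m - l) 0.
  by move=> e /h; apply: (ultra_mono HU) => m; rewrite subr0.
have hk : U (fun m => nm ((fun=> k) m) <= nm k) by apply: ultraW.
have := tendsD (tends_bound0 hk h0) (tends_cst (k * l)).
by rewrite add0r; apply: tends_ext => m; ring.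
Qed.

Lemma tendsB0 x l : tends x l -> tends (fun m => x m - l) 0.
Proof. by move=> h e /h; apply: (ultra_mono HU) => m; rewrite subr0. Qed.

Lemma tendsM x y l l' : tends x l -> tends y l' -> tends (fun m => x m * y m) (l * l').
Proof.
move=> h h'.
have := tendsD (tends_bound0 (tends_nm_bound h) (tendsB0 h')) (tendsZ l' h).
by rewrite add0r mulrC; apply: tends_ext => m; ring.
Qed.

Lemma tends_sum (I : eqType) (s : seq I) (P : pred I) (x : I -> nat -> C) (l : I -> C) :
  (forall i, i \in s -> P i -> tends (x i) (l i)) ->
  tends (fun m => \sum_(i <- s | P i) x i m) (\sum_(i <- s | P i) l i).
Proof.
elim: s => [|i s IH] h.
  by rewrite big_nil; apply: tends_ext (tends_cst 0) => m; rewrite big_nil.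
have hs : tends (fun m => \sum_(i <- s | P i) x i m) (\sum_(i <- s | P i) l i).
  by apply: IH => j js; apply: h; rewrite inE js orbT.
rewrite big_cons; case Pi: (P i).
  apply: tends_ext (tendsD (h i (mem_head _ _) Pi) hs) => m.
  by rewrite big_cons Pi.
by apply: tends_ext hs => m; rewrite big_cons Pi.
Qed.

Lemma tends_prod (I : finType) (x : I -> nat -> C) (l : I -> C) :
  (forall i, tends (x i) (l i)) ->
  tends (fun m => \prod_i x i m) (\prod_i l i).
Proof.
move=> h; elim: (index_enum I) => [|i s IH].
  by rewrite big_nil; apply: tends_ext (tends_cst 1) => m; rewrite big_nil.
rewrite big_cons; apply: tends_ext (tendsM (h i) IH) => m.
by rewrite big_cons.
Qed.

Lemma tendsX x l k : tends x l -> tends (fun m => x m ^+ k) (l ^+ k).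
Proof.
move=> h; elim: k => [|k IH]; first exact: tends_cst.
rewrite exprS; apply: tends_ext (tendsM h IH) => m.
by rewrite exprS.
Qed.

Lemma tends_horner (p : {poly C}) x l : tends x l -> tends (fun m => p.[x m]) p.[l].
Proof.
move=> h; elim/poly_ind: p => [|p c IH].
  by rewrite horner0; apply: tends_ext (tends_cst 0) => m; rewrite horner0.
rewrite hornerMXaddC; apply: tends_ext (tendsD (tendsM IH h) (tends_cst c)) => m.
by rewrite hornerMXaddC.
Qed.

Lemma tends_nm_le x l B : U (fun m => nm (x m) <= B) -> tends x l -> nm l <= B.
Proof.
move=> hB h; rewrite leNgt; apply/negP => lB.
have d : 0 < nm l - B by lra.
have [m [h1 h2]] := ultra_ex HU (ultra_and HU hB (h _ d)).
by have := nm_dist (x m) l; rewrite ler_norml => /andP[? ?]; lra.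
Qed.

Lemma tends_nm_ge x l B : U (fun m => B <= nm (x m)) -> tends x l -> B <= nm l.
Proof.
move=> hB h; rewrite leNgt; apply/negP => lB.
have d : 0 < B - nm l by lra.
have [m [h1 h2]] := ultra_ex HU (ultra_and HU hB (h _ d)).
by have := nm_dist (x m) l; rewrite ler_norml => /andP[? ?]; lra.
Qed.

Lemma tends_nm_real x l : tends x l -> tends (fun m => (nm (x m))%:C%C) (nm l)%:C%C.
Proof.
move=> h e /h; apply: (ultra_mono HU) => m h1.
by rewrite -rmorphB nm_real (le_lt_trans (nm_dist _ _)).
Qed.

Lemma tends_neq0 x l : tends x l -> l != 0 -> U (fun m => nm l / 2 <= nm (x m)).
Proof.
rewrite -nm_gt0 => h l0; have d : 0 < nm l / 2 by lra.
apply: (ultra_mono HU) (h _ d) => m h1.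
by have := nm_dist (x m) l; rewrite ler_norml => /andP[? ?]; lra.
Qed.

Lemma tendsV x l : tends x l -> l != 0 -> tends (fun m => (x m)^-1) l^-1.
Proof.
move=> h l0; have hb := tends_neq0 h l0.
have nl0 : 0 < nm l by rewrite nm_gt0.
have hB : U (fun m => nm (- (x m)^-1 * l^-1) <= (nm l / 2)^-1 * (nm l)^-1).
  apply: (ultra_mono HU) hb => m h1.
  rewrite nmM nmN !nmV ler_wpM2r ?invr_ge0 ?nm_ge0 // lef_pV2 // ?posrE; lra.
have := tendsD (tends_bound0 hB (tendsB0 h)) (tends_cst l^-1).
rewrite add0r; apply: tends_eq; apply: (ultra_mono HU) hb => m h1.
have x0 : x m != 0 by rewrite -nm_gt0; lra.
by field; rewrite ?l0 ?x0.
Qed.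

(** The limit is the supremum of the numbers lying below the sequence for almost every index. Every
    later extraction of a limit rests on this compactness. *)
Lemma real_ultralimit (x : nat -> R) (B : R) : U (fun m => `|x m| <= B) ->
  exists l, forall e, 0 < e -> U (fun m => `|x m - l| < e).
Proof.
move=> hB; pose E := (fun y => U (fun m => y <= x m)) : classical_sets.set R.
have E0 : E (- B).
  by apply: (ultra_mono HU) hB => m; rewrite ler_norml => /andP[].
have EB y : E y -> y <= B.
  move=> h; have [m [h1]] := ultra_ex HU (ultra_and HU h hB).
  by rewrite ler_norml => /andP[_ h2]; lra.
have hs : classical_sets.has_sup E by split; [exists (- B) | exists B].
exists (sup E) => e e0.
have [y Ey ye] := sup_adherent e0 hs.
have nE : ~ E (sup E + e / 2).
  by move=> /(ub_le_sup (proj2 hs)) h; lra.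
case: (ultra_total HU (fun m => sup E + e / 2 <= x m)) => // h.
apply: (ultra_mono HU) (ultra_and HU Ey h) => m [h1 /negP].
rewrite -ltNge => h2; rewrite ltr_norml; apply/andP; split; lra.
Qed.

Lemma ultralimit (x : nat -> C) (B : R) : U (fun m => nm (x m) <= B) ->
  exists l, tends x l.
Proof.
move=> hB.
have [a ha] : exists l, forall e, 0 < e -> U (fun m => `|complex.Re (x m) - l| < e).
  apply: (@real_ultralimit _ B); apply: (ultra_mono HU) hB => m.
  exact: le_trans (Re_le_nm _).
have [b hb] : exists l, forall e, 0 < e -> U (fun m => `|complex.Im (x m) - l| < e).
  apply: (@real_ultralimit _ B); apply: (ultra_mono HU) hB => m.
  exact: le_trans (Im_le_nm _).
exists (a +i* b)%C => e e0; have d : 0 < e / 2 by lra.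
apply: (ultra_mono HU) (ultra_and HU (ha _ d) (hb _ d)) => m [h1 h2].
have := nm_le_ReIm (x m - (a +i* b)%C).
by case: (x m) h1 h2 => u v /= h1 h2 h3; apply: le_lt_trans h3 _; lra.
Qed.

(** Such a limit is also the limit of the moduli, hence equals its own modulus. It carries the sign
    of a multiplier over to the limit relation. *)
Lemma tends_ge0 x l : (forall m, exists2 r : R, 0 <= r & x m = r%:C%C) -> tends x l ->
  exists2 r : R, 0 <= r & l = r%:C%C.
Proof.
move=> hx h.
have -> : l = (nm l)%:C%C.
  apply: (tends_uniq h); apply: tends_ext (tends_nm_real h) => m.
  by have [r r0 ->] := hx m; rewrite nm_real ger0_norm.
by exists (nm l) => //; apply: nm_ge0.
Qed.

Lemma tends_conj x l : tends x l -> tends (fun m => conjc (x m)) (conjc l).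
Proof.
move=> h e /h; apply: (ultra_mono HU) => m.
by rewrite -rmorphB; case: (x m - l) => a b /=; rewrite sqrrN.
Qed.

End Ultralimits.

(** * Integral weights of a sequence of points *)

Lemma pdecP (P : Prop) : reflect P (pdec P).
Proof.
by rewrite /pdec; case: excluded_middle_informative => h; constructor.
Qed.

Definition mono (A : comNzRingType) n (z : 'I_n -> A) (al : 'I_n -> nat) : A :=
  \prod_i z i ^+ al i.
Definition wdot n (w al : 'I_n -> nat) : nat := (\sum_i w i * al i)%N.

Section Weights.
Variables (R : realType) (U : (nat -> Prop) -> Prop).
Hypothesis HU : nat_ultrafilter U.
Local Notation C := (R[i]).
Local Notation nm := (@Normc.normc R).
Local Notation tends := (@tends R U).

Lemma tends_rat_approx (u : R) :
  exists q : nat -> rat, tends (fun m => (ratr (q m))%:C%C) u%:C%C.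
Proof.
have ex m : exists q : rat, ratr q \in `]u, (u + m.+1%:R^-1)[.
  by apply: rat_in_itvoo; rewrite ltrDl invr_gt0 ltr0n.
exists (fun m => xchoose (ex m)) => e e0.
apply: (ultra_mono HU) (ultra_invS_lt HU e0) => m he.
have /itvP h := xchooseP (ex m).
rewrite -rmorphB nm_real ger0_norm ?subr_ge0 ?h //.
rewrite ltrBlDl; apply: lt_trans (_ : u + m.+1%:R^-1 < _); first by rewrite h.
by rewrite ltrD2l.
Qed.

(* Rational vectors are dense in the real points of a rational subspace. *)
Lemma rational_solution n k (T : finType) (Q : T -> Prop) (M : 'M[rat]_(n, k))
    (d : T -> 'cV[rat]_n) (v : 'rV[R]_n) :
  v *m map_mx ratr M = 0 ->
  (forall p, Q p -> 0 < (v *m map_mx ratr (d p)) 0 0) ->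
  exists w : 'rV[rat]_n,
    w *m M = 0 /\ forall p, Q p -> 0 < (w *m d p) 0 0.
Proof.
move=> vM vd.
(* Kernels commute with extension of scalars, so [v] is a real combination of rational rows.
   Approximating only its coefficients keeps [w *m M = 0] exact, while the strict inequalities are
   open conditions. *)
have /submxP[u uE] : (v <= map_mx ratr (kermx M))%MS.
  by rewrite map_kermx; apply/sub_kermxP.
have [q hq] : exists q : 'I_n -> nat -> rat,
    forall j, tends (fun m => (ratr (q j m))%:C%C) (u 0 j)%:C%C.
  exact: (choice _ (fun j => tends_rat_approx (u 0 j))).
pose w m := (\row_j q j m) *m kermx M.
have hw p : Q p -> U (fun m => 0 < (w m *m d p) 0 0).
  move=> Qp.
  pose c j := (kermx M *m d p) j 0.
  have lim : tends (fun m => (ratr ((w m *m d p) 0 0))%:C%C)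
                   ((v *m map_mx ratr (d p)) 0 0)%:C%C.
    have -> : (v *m map_mx ratr (d p)) 0 0 = \sum_j u 0 j * ratr (c j).
      rewrite uE -mulmxA -map_mxM mxE; apply: eq_bigr => j _.
      by rewrite mxE.
    rewrite rmorph_sum /=.
    have := @tends_sum _ _ HU _ (index_enum 'I_n) predT
      (fun j m => (ratr (q j m))%:C%C * (ratr (c j))%:C%C)
      (fun j => (u 0 j)%:C%C * (ratr (c j))%:C%C).
    under [X in tends _ X]eq_bigr do rewrite -rmorphM.
    move=> h; apply: (tends_ext HU _ (h _)) => [m|j _ _]; last first.
      exact: tendsM (hq j) (tends_cst HU _).
    rewrite -mulmxA mxE rmorph_sum /= rmorph_sum /=; apply: eq_bigr => j _.
    by rewrite mxE [ratr (_ * _)]rmorphM [RHS]rmorphM.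
  apply: (ultra_mono HU) (lim _ (vd p Qp)) => m.
  rewrite -rmorphB nm_real ltr_norml => /andP[h _].
  by rewrite -(ltr_rat R) rmorph0; lra.
have hall : U (fun m => forall p, Q p -> 0 < (w m *m d p) 0 0).
  apply: ultra_forall => // p; case: (classic (Q p)) => [/hw|nQ].
    exact: ultra_mono.
  by apply: ultraW.
have [m hm] := ultra_ex HU hall.
by exists (w m); split => //; rewrite -mulmxA mulmx_ker mulmx0.
Qed.

Lemma rat_clear_denominators n (w : 'rV[rat]_n) :
  exists2 N : nat, (0 < N)%N & exists a : 'I_n -> int,
    forall i, N%:R * w 0 i = (a i)%:~R.
Proof.
exists (\prod_i `|denq (w 0%R i)|)%N.
  by rewrite prodn_gt0 // => i; rewrite absz_gt0 denq_neq0.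
exists (fun i => (\prod_(j | j != i) `|denq (w 0%R j)|)%N%:Z * numq (w 0 i)) => i.
set x := w 0 i; rewrite (bigD1 i) //= natrM -/x rmorphM /= numqE -pmulrn.
have -> : `|denq x|%N%:R = (denq x)%:~R :> rat.
  by rewrite -[in RHS](gtz0_abs (denq_gt0 x)) -pmulrn.
by rewrite mulrAC mulrC [x * _]mulrC.
Qed.

Local Notation expR := (@sequences.expR R).

Lemma mono_neq0 n (z : 'I_n -> C) al : (forall i, z i != 0) -> mono z al != 0.
Proof. by move=> h; apply/prodf_neq0 => i _; rewrite expf_neq0. Qed.

Lemma monoM n (y z : 'I_n -> C) al :
  mono (fun i => y i * z i) al = mono y al * mono z al.
Proof. by rewrite /mono -big_split; apply: eq_bigr => i _; rewrite exprMn. Qed.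

Lemma mono_exp n (f : 'I_n -> R) al :
  mono (fun i => (expR (f i))%:C%C) al = (expR (\sum_i (al i)%:R * f i))%:C%C.
Proof.
rewrite exp.expR_sum rmorph_prod; apply: eq_bigr => i _.
by rewrite exp.expRM_natl rmorphXn.
Qed.

Lemma ubounded_sum (I : finType) (f : I -> nat -> R) (c : I -> R) :
  (forall i, exists B : R, U (fun m => `|f i m| <= B)) ->
  exists B : R, U (fun m => `|\sum_i f i m * c i| <= B).
Proof.
move=> /(choice _) [B hB]; exists (\sum_i B i * `|c i|).
apply: (ultra_mono HU) (ultra_forall HU hB) => m h.
apply: (le_trans (ler_norm_sum _ _ _)); apply: ler_sum => i _.
by rewrite normrM ler_wpM2r.
Qed.

(** In the logarithmic coordinates [x_i = - ln |z_i|], a quotient of monomials becomes a linear form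
    [L p] with integral coefficients, and along the ultrafilter each of these finitely many forms is
    bounded or tends to plus or minus infinity. Subtracting a bounded vector from [x] makes the
    bounded forms vanish exactly and keeps the unbounded ones of the right sign. One resulting real
    vector is made rational, then integral: this is [w]. The part of [z] left after dividing out the
    unbounded size converges to [a]. *)
Lemma weights n D (z : nat -> 'I_n -> C) (B : R) :
  (forall m i, z m i != 0) -> (forall i, U (fun m => nm (z m i) <= B)) ->
  exists (w : 'I_n -> nat) (a : 'I_n -> C), (forall i, a i != 0) /\
  forall al be : 'I_n -> nat, (forall i, al i <= D)%N -> (forall i, be i <= D)%N ->
    (wdot w al = wdot w be ->
      tends (fun m => mono (z m) al / mono (z m) be) (mono a al / mono a be)) /\
    ((wdot w be < wdot w al)%N ->
      tends (fun m => mono (z m) al / mono (z m) be) 0).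
Proof.
move=> z0 zB.
(* The bound is [D + 1] rather than [D] so that the exponent 1 is available even for [D = 0]; the
   nonnegativity of the weights is read off from it. *)
pose E := {ffun 'I_n -> 'I_D.+2}; pose T := (E * E)%type.
pose dv (p : T) i : rat := (p.1 i)%:R - (p.2 i)%:R.
pose dR (p : T) i : R := (p.1 i)%:R - (p.2 i)%:R.
have dvR p i : ratr (dv p i) = dR p i by rewrite rmorphB /= !ratr_nat.
pose x m i := - exp.ln (nm (z m i)).
pose L p m := \sum_i dR p i * x m i.
pose bnd p := exists B, U (fun m => `|L p m| <= B).
pose pos p := forall B, U (fun m => B < L p m).
pose sw (p : T) : T := (p.2, p.1).
have dsw p i : dv (sw p) i = - dv p i by rewrite /dv opprB.
have Lsw p m : L (sw p) m = - L p m.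
  rewrite /L -sumrN; apply: eq_bigr => i _.
  by rewrite -mulNr; congr (_ * _); rewrite /dR opprB.
have npos p : ~ pos p -> exists B, U (fun m => L p m <= B).
  move=> /not_all_ex_not [b hb]; exists b.
  case: (ultra_total HU (fun m => b < L p m)) => // h.
  by apply: (ultra_mono HU) h => m /negP; rewrite -leNgt.
have tri p : ~ pos p -> ~ pos (sw p) -> bnd p.
  move=> /npos[b1 h1] /npos[b2 h2]; exists (`|b1| + `|b2|).
  apply: (ultra_mono HU) (ultra_and HU h1 h2) => m [l1 l2].
  rewrite Lsw in l2; have := ler_norm b1; have := ler_norm b2.
  have := normr_ge0 b1; have := normr_ge0 b2.
  by move=> *; rewrite ler_norml; apply/andP; split; lra.
pose M : 'M[rat]_(n, #|{: T}|) :=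
  \matrix_(i, j) if pdec (bnd (enum_val j)) then dv (enum_val j) i else 0.
pose MR := map_mx ratr M : 'M[R]_(n, #|{: T}|).
pose xr m : 'rV[R]_n := \row_i x m i.
(* [x'] takes the same values as [x] on the bounded forms and depends linearly on these values
   through a fixed pseudo-inverse, hence is bounded. *)
pose x' m := xr m *m MR *m pinvmx MR.
pose v m := xr m - x' m.
have vM m : v m *m MR = 0.
  by rewrite mulmxBl mulmxKpV ?subrr ?submxMl.
have xMb j : exists B, U (fun m => `|(xr m *m MR) 0 j| <= B).
  case: (pdecP (bnd (enum_val j))) => hb.
    have [b h] := hb; exists b; apply: (ultra_mono HU) h => m.
    congr (`|_| <= _); rewrite mxE; apply: eq_bigr => i _.
    by rewrite !mxE; case: pdecP => // _; rewrite dvR mulrC.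
  exists 0; apply: (ultraW HU) => m; rewrite mxE big1 ?normr0 // => i _.
  by rewrite !mxE; case: pdecP => // _; rewrite rmorph0 mulr0.
have x'b i : exists B, U (fun m => `|x' m 0 i| <= B).
  have [b h] := ubounded_sum (fun j => (pinvmx MR) j i) xMb.
  by exists b; apply: (ultra_mono HU) h => m; rewrite [x' m 0 i]mxE.
pose Lv p m := \sum_i dR p i * v m 0 i.
have LvE p m : Lv p m = L p m - \sum_i x' m 0 i * dR p i.
  rewrite -sumrB; apply: eq_bigr => i _.
  by rewrite /v !mxE; ring.
have Lvpos p : pos p -> U (fun m => 0 < Lv p m).
  move=> hp; have [b hb] := ubounded_sum (dR p) x'b.
  apply: (ultra_mono HU) (ultra_and HU (hp b) hb) => m [h1].
  by rewrite LvE ler_norml => /andP[_ h2]; lra.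
have Lvbnd p m : bnd p -> Lv p m = 0.
  move=> hp; have := vM m => /matrixP /(_ 0 (enum_rank p)).
  rewrite [in RHS]mxE mxE => <-; apply: eq_bigr => i _.
  by rewrite !mxE enum_rankK; case: pdecP => // _; rewrite dvR mulrC.
(* A single index serves all the pairs, since they are finitely many; only the vector [v m0] is
   needed to produce weights. *)
have [m0 hm0] : exists m, forall p, pos p -> 0 < Lv p m.
  apply: (ultra_ex HU); apply: (ultra_forall HU) => p.
  case: (classic (pos p)) => [hp|np]; last by apply: (ultraW HU).
  by apply: (ultra_mono HU) (Lvpos p hp).
pose dcol p : 'cV[rat]_n := \col_i dv p i.
have [wq [wM wpos]] : exists w : 'rV[rat]_n,
    w *m M = 0 /\ forall p, pos p -> 0 < (w *m dcol p) 0 0.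
  apply: (@rational_solution n _ T pos M dcol _ (vM m0)) => p /hm0.
  congr (0 < _); rewrite mxE; apply: eq_bigr => i _.
  by rewrite [map_mx _ _ _ _]mxE [dcol _ _ _]mxE dvR mulrC.
have [N N0 [ai aiE]] := rat_clear_denominators wq.
pose S p := \sum_i dv p i * (ai i)%:~R.
have SE p : S p = N%:R * (wq *m dcol p) 0 0.
  rewrite mxE mulr_sumr; apply: eq_bigr => i _.
  by rewrite mxE -aiE; ring.
have Spos p : pos p -> 0 < S p.
  by move=> /wpos h; rewrite SE mulr_gt0 // ltr0n.
have Sbnd p : bnd p -> S p = 0.
  move=> hp; rewrite SE; have := wM => /matrixP /(_ 0 (enum_rank p)).
  rewrite [in RHS]mxE => h; rewrite [X in _ * X](_ : _ = 0) ?mulr0 // -h.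
  rewrite !mxE; apply: eq_bigr => i _.
  by rewrite !mxE enum_rankK; case: pdecP.
have Ssw p : S (sw p) = - S p.
  by rewrite /S -sumrN; apply: eq_bigr => i _; rewrite dsw mulNr.
have Sge p : ~ pos (sw p) -> 0 <= S p.
  move=> h; case: (classic (pos p)) => [/Spos/ltW//|h'].
  by rewrite (Sbnd _ (tri _ h' h)).
(* A negative weight would force [- ln |z_i|] to minus infinity, against the bound [B]; the pair
   used is the exponent of [z_i] against the zero exponent. *)
have ai0 i : 0 <= ai i.
  pose p : T := ([ffun j => inord (j == i)], [ffun=> ord0]).
  have valp j : nat_of_ord (p.1 j) = (j == i).
    by rewrite ffunE inordK //; case: (j == i).
  have Lp m : L p m = x m i.
    rewrite /L (bigD1 i) //= big1 ?addr0 => [|j ji]; rewrite /dR valp ffunE.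
      by rewrite eqxx subr0 mul1r.
    by rewrite (negbTE ji) subr0 mul0r.
  have SpE : S p = (ai i)%:~R.
    rewrite /S (bigD1 i) //= big1 ?addr0 => [|j ji]; rewrite /dv valp ffunE.
      by rewrite eqxx subr0 mul1r.
    by rewrite (negbTE ji) subr0 mul0r.
  suff: 0 <= S p by rewrite SpE ler0z.
  apply: Sge => /(_ (exp.ln B)) h.
  have [m [h1 h2]] := ultra_ex HU (ultra_and HU h (zB i)).
  move: h1; rewrite Lsw Lp /x opprK ltNge => /negP; apply.
  rewrite exp.ler_ln ?posrE ?nm_gt0 //.
  by apply: lt_le_trans h2; rewrite nm_gt0.
pose w i := `|ai i|%N.
have wE i : ((w i)%:R : rat) = (ai i)%:~R.
  by rewrite /w -[in RHS](ger0_norm (ai0 i)) -abszE -pmulrn.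
(* This is [z] with the factor [exp (- v)] removed: it keeps the argument of [z_i], and its modulus
   [exp (- x')] stays between positive bounds, so its limit lies in the torus. *)
pose y m i := (expR (- x' m 0 i))%:C%C * (z m i / (nm (z m i))%:C%C).
have nz m i : (nm (z m i))%:C%C != 0 :> C.
  by rewrite fmorph_eq0 nm_eq0.
have nmy m i : nm (y m i) = expR (- x' m 0 i).
  rewrite nmM nm_real ger0_norm ?exp.expR_ge0 // nmM nmV nm_real.
  by rewrite ger0_norm ?nm_ge0 // mulfV ?mulr1 // nm_eq0.
have zy m i : z m i = y m i * (expR (- v m 0 i))%:C%C.
  rewrite /y mulrAC -rmorphM -exp.expRD.
  have -> : - x' m 0 i + - v m 0 i = exp.ln (nm (z m i)).
    by rewrite /v !mxE /x; ring.
  rewrite exp.lnK ?posrE ?nm_gt0 //.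
  by rewrite mulrCA mulfV ?mulr1 //; apply: nz.
have [b hb] := choice _ x'b.
have lim i : exists l, tends (fun m => y m i) l.
  apply: (@ultralimit _ _ HU _ (expR (b i))); apply: (ultra_mono HU) (hb i) => m.
  by rewrite nmy exp.ler_expR ler_norml => /andP[h _]; lra.
have [a ha] := choice _ lim.
have a0 i : a i != 0.
  rewrite -nm_gt0; apply: (lt_le_trans (exp.expR_gt0 (- b i))).
  apply: (tends_nm_ge HU _ (ha i)); apply: (ultra_mono HU) (hb i) => m.
  by rewrite nmy exp.ler_expR ler_norml => /andP[_ h]; lra.
have y0 m i : y m i != 0 by rewrite -nm_gt0 nmy exp.expR_gt0.
exists w, a; split=> // al be alD beD.
pose p : T := ([ffun i => inord (al i)], [ffun i => inord (be i)]).
have p1 i : nat_of_ord (p.1 i) = al i by rewrite ffunE inordK // ltnS leqW.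
have p2 i : nat_of_ord (p.2 i) = be i by rewrite ffunE inordK // ltnS leqW.
have SwE : S p = (wdot w al)%:R - (wdot w be)%:R.
  rewrite /S /wdot !natr_sum -sumrB; apply: eq_bigr => i _.
  by rewrite -wE /dv p1 p2 !natrM; ring.
split=> hw.
- have Sp0 : S p = 0 by rewrite SwE hw subrr.
  have bp : bnd p.
    apply: tri => /Spos; first by rewrite Sp0 ltxx.
    by rewrite Ssw Sp0 oppr0 ltxx.
  have lima ga : tends (fun m => mono (y m) ga) (mono a ga).
    by apply: (tends_prod HU) => i; apply: tendsX.
  have := tendsM HU (lima al) (tendsV HU (lima be) (mono_neq0 be a0)).
  apply: (tends_ext HU) => m.
  have zE ga : mono (z m) ga = mono (y m) ga *
      (expR (- \sum_i (ga i)%:R * v m 0 i))%:C%C.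
    rewrite -sumrN; under [X in expR X]eq_bigr do rewrite -mulrN.
    rewrite -mono_exp -monoM; apply: eq_bigr => i _. by rewrite -zy.
  have eqv : \sum_i (al i)%:R * v m 0 i = \sum_i (be i)%:R * v m 0 i.
    apply/eqP; rewrite -subr_eq0 -sumrB; apply/eqP.
    rewrite -[RHS](Lvbnd p m bp) /Lv.
    by apply: eq_bigr => i _; rewrite /dR p1 p2 mulrBl.
  rewrite !zE eqv -mulf_div divff ?mulr1 //.
  by rewrite fmorph_eq0 gt_eqF ?exp.expR_gt0.
- have pp : pos p.
    apply: NNPP => np; have := Sge (sw p); rewrite Ssw => /(_ np).
    by rewrite SwE oppr_ge0 subr_le0 ler_nat leqNgt hw.
  move=> e e0; apply: (ultra_mono HU) (pp (- exp.ln e)) => m hm.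
  have nmE ga : nm (mono (z m) ga) = expR (- \sum_i (ga i)%:R * x m i).
    rewrite nm_prod -sumrN exp.expR_sum; apply: eq_bigr => i _.
    by rewrite -mulrN exp.expRM_natl nmX /x opprK exp.lnK ?posrE ?nm_gt0.
  rewrite subr0 nmM nmV !nmE -exp.expRN opprK -exp.expRD.
  rewrite -[e in X in _ < X]exp.lnK ?posrE // exp.ltr_expR.
  have LE : L p m = \sum_i (al i)%:R * x m i - \sum_i (be i)%:R * x m i.
    by rewrite -sumrB; apply: eq_bigr => i _; rewrite /dR p1 p2 mulrBl.
  by lra.
Qed.

End Weights.

(** * Sequences with identically vanishing coordinates *)

Section SupportedWeights.
Variables (R : realType) (U : (nat -> Prop) -> Prop).
Hypothesis HU : nat_ultrafilter U.
Local Notation C := (R[i]).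
Local Notation nm := (@Normc.normc R).
Local Notation tends := (@tends R U).
Variable n : nat.

Definition supported (J : {set 'I_n}) (al : 'I_n -> nat) : Prop :=
  forall i, i \notin J -> al i = 0%N.

(* [w] and [a] play the role of the exponents and leading coefficients of a
   parametrised curve z_i = a_i s^(w_i) + ..., as far as the monomials of
   degree at most [D] in each variable can tell; [J] is the set of coordinates
   that do not vanish along the sequence. *)
Record adapted (J : {set 'I_n}) (D : nat) (z : nat -> 'I_n -> C)
    (w : 'I_n -> nat) (a : 'I_n -> C) : Prop := Adapted {
  adapted_neq0 : forall i, a i != 0;
  adapted_supp : U (fun m => forall i, (z m i != 0) = (i \in J));
  adapted_lim : forall i, w i = 0%N -> tends (fun m => z m i) (a i);
  adapted_lim0 : forall i, w i != 0%N -> tends (fun m => z m i) 0;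
  adapted_out : forall i, i \notin J -> w i != 0%N;
  adapted_far : forall al be, supported J be -> (forall i, be i <= D)%N ->
    ~ supported J al -> (wdot w be < wdot w al)%N;
  adapted_eq : forall al be, supported J be ->
    (forall i, al i <= D)%N -> (forall i, be i <= D)%N -> wdot w al = wdot w be ->
    tends (fun m => mono (z m) al / mono (z m) be) (mono a al / mono a be);
  adapted_lt : forall al be, supported J be ->
    (forall i, al i <= D)%N -> (forall i, be i <= D)%N -> (wdot w be < wdot w al)%N ->
    tends (fun m => mono (z m) al / mono (z m) be) 0 }.

Lemma wdot_eq (w w' al : 'I_n -> nat) :
  (forall i, al i != 0%N -> w i = w' i) -> wdot w al = wdot w' al.
Proof.
move=> h; apply: eq_bigr => i _.
by case: (altP (al i =P 0%N)) => [->|/h ->]; rewrite ?muln0.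
Qed.

Lemma mono_eq (z z' : 'I_n -> C) (al : 'I_n -> nat) :
  (forall i, al i != 0%N -> z i = z' i) -> mono z al = mono z' al.
Proof.
move=> h; apply: eq_bigr => i _.
by case: (altP (al i =P 0%N)) => [->|/h ->].
Qed.

Lemma mono_eq0 (z : 'I_n -> C) (al : 'I_n -> nat) i :
  z i = 0 -> al i != 0%N -> mono z al = 0.
Proof. by move=> zi h; rewrite /mono (bigD1 i) //= zi expr0n (negbTE h) mul0r. Qed.

Lemma supportedPn J al : ~ supported J al -> exists2 i, i \notin J & al i != 0%N.
Proof.
move=> h; apply: NNPP => h'; apply: h => i iJ.
by apply/eqP; apply: contraT => hi; case: h'; exists i.
Qed.

Lemma adapted_mono_neq0 J D z w a (al : 'I_n -> nat) :
  adapted J D z w a -> supported J al -> U (fun m => mono (z m) al != 0).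
Proof.
move=> had alJ; apply: (ultra_mono HU) (adapted_supp had) => m hm.
apply/prodf_neq0 => i _; case: (boolP (i \in J)) => [|/alJ ->].
  by rewrite -hm => zi; rewrite expf_neq0.
by rewrite expr0 oner_neq0.
Qed.

Definition unit_exp (i : 'I_n) : 'I_n -> nat := fun j => (j == i)%N.

Lemma mono_unit (z : 'I_n -> C) i : mono z (unit_exp i) = z i.
Proof.
rewrite /mono (bigD1 i) //= /unit_exp eqxx expr1 big1 ?mulr1 // => j /negbTE ->.
by rewrite expr0.
Qed.

Lemma mono_zero (z : 'I_n -> C) : mono z (fun=> 0%N) = 1.
Proof. by rewrite /mono big1. Qed.

Lemma wdot_unit (w : 'I_n -> nat) i : wdot w (unit_exp i) = w i.
Proof.
rewrite /wdot (bigD1 i) //= /unit_exp eqxx muln1 big1 ?addn0 // => j /negbTE ->.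
by rewrite muln0.
Qed.

Lemma wdot_zero (w : 'I_n -> nat) : wdot w (fun=> 0%N) = 0%N.
Proof. by rewrite /wdot big1 // => i _; rewrite muln0. Qed.

Lemma wdot_neq0 (w al : 'I_n -> nat) : wdot w al != 0%N ->
  exists2 i, w i != 0%N & al i != 0%N.
Proof.
move=> h; apply: NNPP => no; move/eqP: h; apply; apply: big1 => i _; apply/eqP.
by rewrite muln_eq0 -implyNb; apply/implyP => wi; apply: contraT => ali; case: no; exists i.
Qed.

(** Vanishing coordinates have no logarithm: they are replaced by 1 to obtain weights, then given a
    very large weight, as if they tended to 0 faster than every relevant monomial in the others. The
    bound [D.+1] makes the coordinates themselves admissible monomials, which yields their
    limits. *)
Lemma adapted_exists (J : {set 'I_n}) D (z : nat -> 'I_n -> C) (B : R) :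
  U (fun m => forall i, (z m i != 0) = (i \in J)) ->
  (forall i, U (fun m => nm (z m i) <= B)) ->
  exists w a, adapted J D z w a.
Proof.
move=> zJ zB.
pose z' m i := if z m i == 0 then 1 else z m i.
have z'0 m i : z' m i != 0.
  by rewrite /z'; case: ifP => [_|/negbT//]; apply: oner_neq0.
have z'B i : U (fun m => nm (z' m i) <= `|B| + 1).
  apply: (ultra_mono HU) (zB i) => m h; rewrite /z'.
  have h1 := ler_norm B; have h2 := normr_ge0 B.
  by case: ifP => _; [rewrite (Normc.normc1 R)|]; lra.
have [w [a [a0 hwa]]] := weights HU D.+1 z'0 z'B.
(* [W] exceeds the weight of every exponent bounded by [D.+1], so any exponent involving a
   coordinate outside [J] outweighs all those supported in [J]. *)
pose W := (\sum_i w i * D.+1).+1.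
pose w' i := if i \in J then w i else W.
pose a' i := if i \in J then a i else 1.
have Jin al i : supported J al -> al i != 0%N -> i \in J.
  by move=> h; apply: contraNT => /h ->.
have w'E al : supported J al -> wdot w' al = wdot w al.
  by move=> h; apply: wdot_eq => i /(Jin _ _ h) iJ; rewrite /w' iJ.
have a'E al : supported J al -> mono a' al = mono a al.
  by move=> h; apply: mono_eq => i /(Jin _ _ h) iJ; rewrite /a' iJ.
have z'E al : supported J al -> U (fun m => mono (z' m) al = mono (z m) al).
  move=> h; apply: (ultra_mono HU) zJ => m hm.
  by apply: mono_eq => i /(Jin _ _ h); rewrite -hm /z' => /negbTE ->.
have far al be : supported J be -> (forall i, be i <= D.+1)%N ->
    ~ supported J al -> (wdot w' be < wdot w' al)%N.
  move=> hb hbD /supportedPn[i iJ ali].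
  rewrite w'E //; apply: (@leq_trans W).
    by rewrite ltnS; apply: leq_sum => j _; rewrite leq_mul.
  rewrite /wdot (bigD1 i) //= /w' (negbTE iJ); apply: leq_trans (leq_addr _ _).
  by rewrite leq_pmulr // lt0n.
have ratio al be l : supported J al -> supported J be ->
    tends (fun m => mono (z' m) al / mono (z' m) be) l ->
    tends (fun m => mono (z m) al / mono (z m) be) l.
  move=> ha hb; apply: (tends_eq HU).
  by apply: (ultra_mono HU) (ultra_and HU (z'E _ ha) (z'E _ hb)) => m [-> ->].
have req al be : supported J be ->
    (forall i, al i <= D.+1)%N -> (forall i, be i <= D.+1)%N -> wdot w' al = wdot w' be ->
    tends (fun m => mono (z m) al / mono (z m) be) (mono a' al / mono a' be).
  move=> hb haD hbD hE; have ha : supported J al.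
    by apply: NNPP => h; have := far al be hb hbD h; rewrite hE ltnn.
  rewrite !a'E //; apply: ratio => //.
  by apply: (proj1 (hwa al be haD hbD)); rewrite -!w'E.
have rlt al be : supported J be ->
    (forall i, al i <= D.+1)%N -> (forall i, be i <= D.+1)%N -> (wdot w' be < wdot w' al)%N ->
    tends (fun m => mono (z m) al / mono (z m) be) 0.
  move=> hb haD hbD hE; case: (classic (supported J al)) => ha.
    apply: ratio => //.
    by apply: (proj2 (hwa al be haD hbD)); rewrite -!w'E.
  have [i iJ ali] := supportedPn ha.
  apply: (tends_eq HU) (tends_cst HU 0); apply: (ultra_mono HU) zJ => m hm.
  rewrite (@mono_eq0 _ _ i) ?mul0r //.
  by apply/eqP; have := hm i; rewrite (negbTE iJ) => /negbFE.
have uD i j : (unit_exp i j <= D.+1)%N by rewrite /unit_exp; case: eqP.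
exists w', a'; split=> //.
- by move=> i; rewrite /a'; case: ifP => // _; apply: oner_neq0.
- move=> i wi.
  have := req (unit_exp i) (fun=> 0%N) (fun _ _ => erefl) (uD i) (fun=> leq0n _).
  rewrite wdot_unit wdot_zero => /(_ wi).
  rewrite mono_unit mono_zero divr1; apply: (tends_ext HU) => m.
  by rewrite mono_unit mono_zero divr1.
- move=> i wi.
  have := rlt (unit_exp i) (fun=> 0%N) (fun _ _ => erefl) (uD i) (fun=> leq0n _).
  rewrite wdot_unit wdot_zero lt0n => /(_ wi).
  apply: (tends_ext HU) => m.
  by rewrite mono_unit mono_zero divr1.
- by move=> i iJ; rewrite /w' (negbTE iJ).
- by move=> al be hb hbD; apply: far => // i; apply: leqW.
- by move=> al be hb h1 h2; apply: req => // i; apply: leqW.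
- by move=> al be hb h1 h2; apply: rlt => // i; apply: leqW.
Qed.

End SupportedWeights.

(** * Newton polyhedra and face functions *)

Section Newton.
Variable R : realType.
Local Notation C := (R[i]).
Variable n : nat.
Implicit Types (g h : {mpoly C[n]}) (F : {mpoly {poly C}[n]}) (z a : 'I_n -> C).

(** The coefficients are allowed to vanish: [f_t] and its face functions are all written over the
    fixed list [msupp F], although their supports vary with [t]. *)
Definition sumX (s : seq 'X_{1..n}) (P : pred 'X_{1..n}) (c : 'X_{1..n} -> C) :
  {mpoly C[n]} := \sum_(m <- s | P m) c m *: 'X_[m].

Lemma sumX_eval s P c z : (sumX s P c).@[z] = \sum_(m <- s | P m) c m * mono z m.
Proof.
by rewrite rmorph_sum /=; apply: eq_bigr => m _; rewrite mevalZ mevalX.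
Qed.

Lemma sumX_grad s P c z i :
  z i * grad (sumX s P c) z i = \sum_(m <- s | P m) (m i)%:R * c m * mono z m.
Proof.
rewrite /grad /sumX [mderiv _ _]raddf_sum /= rmorph_sum /= mulr_sumr; apply: eq_bigr => m _.
rewrite mderivZ mderivX mevalZ mevalZ mevalX.
case mi: (m i) => [|k]; first by rewrite !mul0r mulr0 mulr0.
suff -> : mono z m = z i * \prod_j z j ^+ (m - U_(i))%MM j by ring.
rewrite /mono (bigD1 i) //= [in RHS](bigD1 i) //= mulrA; congr (_ * _).
  by rewrite mnmBE mnm1E eqxx mi subn1 /= exprS.
apply: eq_bigr => j ji.
by rewrite mnmBE mnm1E eq_sym (negbTE ji) subn0.
Qed.

Lemma sumX_coef s P c m : uniq s ->
  (sumX s P c)@_m = if (m \in s) && P m then c m else 0.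
Proof.
move=> us; rewrite /sumX raddf_sum /=.
under eq_bigr do rewrite mcoeffZ mcoeffX.
case: ifPn => [/andP[ms Pm]|h].
  rewrite big_mkcond (bigD1_seq m) //= Pm eqxx mulr1 big1 ?addr0 // => k.
  by move=> /negbTE ->; rewrite mulr0; case: ifP.
rewrite big_seq_cond big1 // => k /andP[ks Pk].
case: eqP => [E|_]; last by rewrite mulr0.
by move: h; rewrite -E ks Pk.
Qed.

Lemma fspec_coef F t m : (fspec F t)@_m = (F@_m).[t].
Proof. by rewrite mcoeff_map_mpoly. Qed.

Lemma fspec_msupp F t m : m \in msupp (fspec F t) -> m \in msupp F.
Proof.
rewrite !mcoeff_msupp fspec_coef; apply: contra => /eqP ->.
by rewrite horner0.
Qed.

Lemma fspecE F t : fspec F t = sumX (msupp F) predT (fun m => (F@_m).[t]).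
Proof.
apply/mpolyP => m; rewrite fspec_coef sumX_coef ?msupp_uniq // andbT.
case: ifPn => // /memN_msupp_eq0 ->; by rewrite horner0.
Qed.

Lemma dotR_expvec (w : 'I_n -> nat) m :
  dotR (fun i => (w i)%:R) (expvec R m) = (wdot w m)%:R.
Proof. by rewrite /wdot natr_sum; apply: eq_bigr => i _; rewrite natrM. Qed.

Lemma Gamma_plus_expvec g m : m \in msupp g -> Gamma_plus g (expvec R m).
Proof.
move=> mg; exists 1%N, (fun=> expvec R m), (fun=> 1); split => //.
- by move=> _; exists m.
- by rewrite big_ord1.
- by move=> i; rewrite big_ord1 mul1r.
Qed.

(** A convex combination cannot weigh less than all of its points, and moving up from an exponent
    does not lower a nonnegative weight. Minima over the polyhedron thereby become minima over
    exponents. *)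
Lemma Gamma_plus_exp_le g (w : 'I_n -> nat) x : Gamma_plus g x ->
  exists2 m, m \in msupp g & (wdot w m)%:R <= dotR (fun i => (w i)%:R) x.
Proof.
case=> k [p [mu [hp mu0 mu1 xE]]].
apply: NNPP => no.
have lt m : m \in msupp g -> dotR (fun i => (w i)%:R) x < (wdot w m)%:R.
  by move=> mg; rewrite ltNge; apply/negP => h; case: no; exists m.
pose u i : R := (w i)%:R.
have hj j : dotR u x < dotR u (p j).
  have [m mg hm] := hp j; apply: lt_le_trans (lt m mg) _.
  by rewrite -dotR_expvec; apply: ler_sum => i _; rewrite ler_wpM2l ?ler0n.
have E : dotR u x = \sum_j mu j * dotR u (p j).
  rewrite /dotR; under [RHS]eq_bigr do rewrite mulr_sumr.
  rewrite exchange_big; apply: eq_bigr => i _; rewrite xE mulr_sumr.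
  by apply: eq_bigr => j _; rewrite mulrCA.
have : 0 < \sum_j mu j * (dotR u (p j) - dotR u x).
  have ex : exists j, mu j != 0.
    apply: NNPP => h; have := mu1; rewrite big1 => [/esym/eqP|j _].
      by rewrite oner_eq0.
    by apply/eqP; apply: contraT => hj0; case: h; exists j.
  have [j mj] := ex; rewrite (bigD1 j) //= ltr_pwDl //.
    by rewrite mulr_gt0 ?subr_gt0 // lt_def mj mu0.
  by apply: sumr_ge0 => i _; rewrite mulr_ge0 // subr_ge0 ltW.
under eq_bigr do rewrite mulrBr.
by rewrite sumrB -E -mulr_suml mu1 mul1r subrr ltxx.
Qed.

Lemma Gamma_plus_ge0 g x i : Gamma_plus g x -> 0 <= x i.
Proof.
case=> k [p [mu [hp mu0 _ ->]]]; apply: sumr_ge0 => j _.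
rewrite mulr_ge0 //; have [m _ /(_ i)] := hp j.
by apply: le_trans; rewrite ler0n.
Qed.

Lemma min_exponent (w : 'I_n -> nat) g m0 : m0 \in msupp g ->
  exists2 m, m \in msupp g & forall al, al \in msupp g -> (wdot w m <= wdot w al)%N.
Proof.
move=> m0g; elim/ltn_ind: {m0}(wdot w m0) {-2}m0 (erefl (wdot w m0)) m0g.
move=> N IH m0 N0 m0g.
case: (classic (exists2 m, m \in msupp g & (wdot w m < N)%N)) => [[m mg hm]|no].
  exact: (IH _ hm m).
exists m0 => // al alg; rewrite N0 leqNgt; apply/negP => h.
by case: no; exists al.
Qed.

Lemma face_fnE (w : 'I_n -> nat) F t (be : 'X_{1..n}) :
  be \in msupp (fspec F t) ->
  (forall al, al \in msupp (fspec F t) -> (wdot w be <= wdot w al)%N) ->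
  face_fn w (fspec F t) =
    sumX (msupp F) (fun m => wdot w m == wdot w be) (fun m => (F@_m).[t]).
Proof.
move=> beg bemin; set g := fspec F t in beg bemin *.
have DeltaE m : m \in msupp g ->
    pdec (Delta w g (expvec R m)) = (wdot w m == wdot w be).
  move=> mg; apply/pdecP/eqP => [[_ /(_ _ (Gamma_plus_expvec beg))]|E].
    rewrite !dotR_expvec ler_nat => h.
    by apply/eqP; rewrite eqn_leq h bemin.
  split; first exact: Gamma_plus_expvec.
  move=> y /(@Gamma_plus_exp_le _ w)[al alg]; apply: le_trans.
  by rewrite dotR_expvec E ler_nat bemin.
have -> : face_fn w g = sumX (msupp g) (fun m => wdot w m == wdot w be) (fun m => g@_m).
  rewrite /face_fn /sumX big_seq_cond [RHS]big_seq_cond; apply: eq_bigl => m.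
  by case mg: (m \in msupp g) => //=; rewrite DeltaE.
apply/mpolyP => m; rewrite !sumX_coef ?msupp_uniq // fspec_coef.
case mg: (m \in msupp g).
  by rewrite (fspec_msupp mg).
rewrite /=; case: ifP => // _.
by have := mg; rewrite mcoeff_msupp fspec_coef => /negbFE/eqP ->.
Qed.

(** For a positive weight, a minimising exponent of [g] lies on a compact face, hence in the Newton
    boundary of [h] and in its polyhedron, so some exponent of [h] weighs no more. A weight with
    zeros may define a noncompact face and is perturbed to a positive one. *)
Lemma newton_boundary_weights g h :
  (forall x, newton_boundary g x -> newton_boundary h x) ->
  forall (w : 'I_n -> nat) al, al \in msupp g ->
    exists2 be, be \in msupp h & (wdot w be <= wdot w al)%N.
Proof.
move=> gh.
have pos (w : 'I_n -> nat) al : (forall i, 0 < w i)%N -> al \in msupp g ->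
    exists2 be, be \in msupp h & (wdot w be <= wdot w al)%N.
  move=> w0 alg; have [m mg mmin] := min_exponent w alg.
  pose u i : R := (w i)%:R.
  have nbm : newton_boundary g (expvec R m).
    exists u; split; last first.
      split; first exact: Gamma_plus_expvec.
      move=> y /(@Gamma_plus_exp_le _ w)[k kg]; apply: le_trans.
      by rewrite dotR_expvec ler_nat mmin.
    exists (wdot w m)%:R => x [xG /(_ _ (Gamma_plus_expvec mg))].
    rewrite dotR_expvec => hx i; have x0 j := Gamma_plus_ge0 j xG.
    rewrite ger0_norm //; apply: le_trans hx.
    rewrite /dotR (bigD1 i) //= -[leLHS]addr0 lerD //.
      by rewrite ler_peMl // ler1n.
    by apply: sumr_ge0 => j _; rewrite mulr_ge0 ?ler0n.
  have [u' [_ [hG _]]] := gh _ nbm.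
  have [be beh] := Gamma_plus_exp_le w hG.
  rewrite dotR_expvec ler_nat => le; exists be => //.
  exact: leq_trans le (mmin _ alg).
(* [N] exceeds the total degree of [al], so the added 1 in each weight cannot compensate a
   difference of one unit in the [w]-weights. *)
move=> w al alg; pose N := (\sum_i al i).+1.
have [be beh] := pos (fun i => N * w i + 1)%N al (fun i => leq_addl (N * w i) 1) alg.
have E (k : 'X_{1..n}) : wdot (fun i => N * w i + 1)%N k = (N * wdot w k + \sum_i k i)%N.
  rewrite /wdot big_distrr -big_split; apply: eq_bigr => i _ /=.
  by rewrite mulnDl mul1n mulnA.
rewrite !E => le; exists be => //.
rewrite -ltnS -(ltn_pmul2l (ltn0Sn (\sum_i al i))) -/N.
apply: (leq_ltn_trans (leq_trans (leq_addr _ _) le)).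
by rewrite mulnS addnC ltn_add2r.
Qed.

End Newton.

(** * Leading terms along a sequence *)

Section Leading.
Variables (R : realType) (U : (nat -> Prop) -> Prop).
Hypothesis HU : nat_ultrafilter U.
Local Notation C := (R[i]).
Local Notation tends := (@tends R U).
Variable n : nat.

(** After division by the monomial of [be], terms of larger weight tend to 0, those of equal weight
    converge to their value at [a], and those of smaller weight have a coefficient that vanishes at
    [t m]. Values correspond to [phi = 1], and [z_i d_i] to the [i]-th exponent. *)
Lemma tends_leading (J : {set 'I_n}) D z w a (F : {mpoly {poly C}[n]}) t t0
    (be : 'X_{1..n}) (phi : 'X_{1..n} -> C) :
  adapted U J D z w a -> supported J be -> (forall i, be i <= D)%N ->
  (forall al, al \in msupp F -> forall i, al i <= D)%N ->
  tends t t0 ->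
  U (fun m => forall al, al \in msupp (fspec F (t m)) -> (wdot w be <= wdot w al)%N) ->
  tends (fun m => (\sum_(al <- msupp F) phi al * (F@_al).[t m] * mono (z m) al)
                  / mono (z m) be)
    ((\sum_(al <- msupp F | wdot w al == wdot w be) phi al * (F@_al).[t0] * mono a al)
       / mono a be).
Proof.
move=> had bJ bD FD tt0 hmin.
rewrite big_mkcond /= mulr_suml.
have := @tends_sum R U HU _ (msupp F) predT
  (fun al m => phi al * (F@_al).[t m] * (mono (z m) al / mono (z m) be))
  (fun al => (if wdot w al == wdot w be then phi al * (F@_al).[t0] * mono a al else 0)
             / mono a be).
move=> h; apply: (tends_ext HU _ (h _)) => [m|al alF _].
  by rewrite mulr_suml; apply: eq_bigr => al _; rewrite mulrA.
have lc : tends (fun m => phi al * (F@_al).[t m]) (phi al * (F@_al).[t0]).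
  by apply: tendsZ => //; apply: tends_horner.
have alD := FD _ alF.
case: (ltngtP (wdot w al) (wdot w be)) => [lt|gt|E].
- rewrite mul0r; apply: (tends_eq HU) (tends_cst HU 0).
  apply: (ultra_mono HU) hmin => m /(_ al) hm.
  have -> : (F@_al).[t m] = 0; last by rewrite mulr0 mul0r.
  apply/eqP; apply: contraT; rewrite -fspec_coef -mcoeff_msupp => /hm.
  by rewrite leqNgt lt.
- rewrite mul0r -[0](mulr0 (phi al * (F@_al).[t0])).
  by apply: (tendsM HU lc); apply: (adapted_lt had).
- rewrite -mulrA; apply: (tendsM HU lc); exact: (adapted_eq had).
Qed.

End Leading.

(** * Limits of polynomials in terms of face functions *)

Section FaceLimits.
Variables (R : realType) (U : (nat -> Prop) -> Prop).
Hypothesis HU : nat_ultrafilter U.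
Local Notation C := (R[i]).
Local Notation nm := (@Normc.normc R).
Local Notation tends := (@tends R U).
Variable n : nat.
Implicit Types (F : {mpoly {poly C}[n]}) (be : 'X_{1..n}).

(** Inclusion of the Newton polyhedron at [t] in the one at [t0], as tested by weights; the form in
    which constancy of the Newton boundary enters the limits. *)
Definition newton_dominates F (t t0 : C) : Prop :=
  forall (w : 'I_n -> nat) al, al \in msupp (fspec F t) ->
    exists2 be, be \in msupp (fspec F t0) & (wdot w be <= wdot w al)%N.

Lemma face_fn_euler F t0 (w : 'I_n -> nat) be (a : 'I_n -> C) :
  be \in msupp (fspec F t0) ->
  (forall al, al \in msupp (fspec F t0) -> (wdot w be <= wdot w al)%N) ->
  \sum_i (w i)%:R * (a i * grad (face_fn w (fspec F t0)) a i) =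
    (wdot w be)%:R * (face_fn w (fspec F t0)).@[a].
Proof.
move=> bF bmin; rewrite (face_fnE bF bmin) sumX_eval.
under eq_bigr do rewrite sumX_grad mulr_sumr.
rewrite exchange_big mulr_sumr /=; apply: eq_bigr => m /eqP <-.
rewrite /wdot natr_sum mulr_suml; apply: eq_bigr => i _.
by rewrite natrM; ring.
Qed.

Lemma tends_fspec_sum F (phi : 'X_{1..n} -> C) (t : nat -> C) t0
    (z : nat -> 'I_n -> C) z0 :
  tends t t0 -> (forall i, tends (fun m => z m i) (z0 i)) ->
  tends (fun m => \sum_(al <- msupp F) phi al * (F@_al).[t m] * mono (z m) al)
    (\sum_(al <- msupp F) phi al * (F@_al).[t0] * mono z0 al).
Proof.
move=> tt0 zz0; apply: (tends_sum HU) => al _ _.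
apply: tendsM => //; first by apply: tendsZ => //; apply: tends_horner.
by apply: tends_prod => // i; apply: tendsX.
Qed.

Lemma fspec_evalE F t (z : 'I_n -> C) :
  (fspec F t).@[z] = \sum_(al <- msupp F) 1 * (F@_al).[t] * mono z al.
Proof. by rewrite fspecE sumX_eval; apply: eq_bigr => al _; rewrite mul1r. Qed.

Lemma fspec_gradE F t (z : 'I_n -> C) i :
  z i * grad (fspec F t) z i =
    \sum_(al <- msupp F) (al i)%:R * (F@_al).[t] * mono z al.
Proof. by rewrite fspecE sumX_grad. Qed.

Lemma face_limits (J : {set 'I_n}) D (z : nat -> 'I_n -> C) w a F t t0 :
  adapted U J D z w a ->
  (forall al, al \in msupp F -> forall i, al i <= D)%N ->
  tends t t0 -> U (fun m => newton_dominates F (t m) t0) ->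
  U (fun m => exists2 al, al \in msupp (fspec F (t m)) & supported J al) ->
  exists be : 'X_{1..n},
    [/\ be \in msupp (fspec F t0), supported J be,
        forall al, al \in msupp (fspec F t0) -> (wdot w be <= wdot w al)%N,
        tends (fun m => (fspec F (t m)).@[z m] / mono (z m) be)
          ((face_fn w (fspec F t0)).@[a] / mono a be)
      & forall i, tends (fun m => z m i * grad (fspec F (t m)) (z m) i / mono (z m) be)
          (a i * grad (face_fn w (fspec F t0)) a i / mono a be)].
Proof.
move=> had FD tt0 dom sup.
have [be0 be0F be0J] : exists2 be, be \in msupp (fspec F t0) & supported J be.
  have [m [d [al alF alJ]]] := ultra_ex HU (ultra_and HU dom sup).
  (* For the indicator of the complement of [J], weight 0 means support in [J]; domination thus
     transports such an exponent from [t m] to [t0]. *)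
  pose w' (i : 'I_n) : nat := (i \notin J).
  have [be beF] := d w' al alF.
  have -> : wdot w' al = 0%N.
    rewrite /wdot big1 // => i _; rewrite /w'.
    by case: (boolP (i \in J)) => // /alJ ->.
  rewrite leqn0 sum_nat_eq0 => /forallP h; exists be => // i iJ.
  by have := h i; rewrite /w' iJ mul1n => /eqP.
have [be beF bemin] := min_exponent w be0F.
have bD k : k \in msupp (fspec F t0) -> forall i, (k i <= D)%N.
  by move=> /fspec_msupp; apply: FD.
have beJ : supported J be.
  apply: NNPP => h; have := adapted_far had be0J (bD _ be0F) h.
  by rewrite ltnNge bemin.
have hmin : U (fun m => forall al, al \in msupp (fspec F (t m)) ->
    (wdot w be <= wdot w al)%N).
  apply: (ultra_mono HU) dom => m d al /(d w)[be' /bemin h1 h2].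
  exact: leq_trans h1 h2.
have lead phi := tends_leading HU phi had beJ (bD _ beF) FD tt0 hmin.
exists be; split=> // [|i].
- have := lead (fun=> 1).
  rewrite (face_fnE beF bemin) sumX_eval; under [X in tends _ (X / _)]eq_bigr do rewrite mul1r.
  by apply: (tends_ext HU) => m; rewrite fspec_evalE.
- have := lead (fun al => (al i)%:R).
  rewrite (face_fnE beF bemin) sumX_grad.
  by apply: (tends_ext HU) => m; rewrite fspec_gradE.
Qed.

(** Compactness of the unit sphere for the sum of moduli: the normalised moduli add up to 1, so the
    limits cannot all vanish. *)
Lemma normalized_limits (I : finType) (b : I -> nat -> C) :
  U (fun m => exists k, b k m != 0) ->
  let s m := \sum_k nm (b k m) in
  U (fun m => 0 < s m) /\
  exists2 b' : I -> C, (exists k, b' k != 0) &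
    forall k, tends (fun m => b k m / (s m)%:C%C) (b' k).
Proof.
move=> bn s.
have s0 : U (fun m => 0 < s m).
  apply: (ultra_mono HU) bn => m [k hk]; rewrite /s (bigD1 k) //=.
  by rewrite ltr_pwDl ?nm_gt0 // sumr_ge0 // => j _; apply: nm_ge0.
split=> //.
have nmE k : U (fun m => nm (b k m / (s m)%:C%C) = nm (b k m) / s m).
  apply: (ultra_mono HU) s0 => m sm.
  by rewrite nmM nmV nm_real gtr0_norm.
have lim k : exists l, tends (fun m => b k m / (s m)%:C%C) l.
  apply: (@ultralimit _ _ HU _ 1); apply: (ultra_mono HU) (ultra_and HU s0 (nmE k)).
  move=> m [sm ->]; rewrite ler_pdivrMr // mul1r /s (bigD1 k) //= lerDl.
  by rewrite sumr_ge0 // => j _; apply: nm_ge0.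
have [b' hb'] := choice _ lim; exists b' => //.
apply: NNPP => no.
have b0 k : b' k = 0 by apply/eqP; apply: contraT => h; case: no; exists k.
have := @tends_sum _ _ HU _ (index_enum I) predT _ _
  (fun k _ _ => tends_nm_real HU (hb' k)).
rewrite [X in tends _ X]big1 => [|k _]; last by rewrite b0 Normc.normc0.
move=> h; have := tends_uniq HU h; move=> /(_ 1) E.
have : (0 : C) = 1.
  apply: E; apply: (tends_eq HU) (tends_cst HU 1).
  apply: (ultra_mono HU) (ultra_and HU s0 (ultra_forall HU nmE)) => m [sm sE].
  rewrite -rmorph_sum /=; under eq_bigr do rewrite sE.
  by rewrite -mulr_suml divff // gt_eqF.
by move/esym/eqP; rewrite oner_eq0.
Qed.

Lemma lin_indep_scaled k0 (S : {set 'I_k0}) (J : pred 'I_n)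
    (v : 'I_k0 -> 'I_n -> C) (a : 'I_n -> C) (q b : 'I_k0 -> C) :
  lin_indep S J v -> (forall i, a i != 0) -> (forall k, q k != 0) ->
  (forall i, J i -> \sum_(k in S) b k * (a i * v k i / q k) = 0) ->
  forall k, k \in S -> b k = 0.
Proof.
move=> li a0 q0 h k kS.
have /li /(_ k kS) : forall i, J i -> \sum_(k in S) (b k / q k) * v k i = 0.
  move=> i /h E; apply: (mulfI (a0 i)); rewrite mulr0 -[RHS]E mulr_sumr.
  by apply: eq_bigr => j _; ring.
by move/eqP; rewrite mulf_eq0 invr_eq0 (negbTE (q0 k)) orbF => /eqP.
Qed.

Lemma grad_prod k0 (G : 'I_k0 -> {mpoly C[n]}) (z : 'I_n -> C) i :
  (forall k, (G k).@[z] != 0) ->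
  grad (\prod_k G k) z i =
    (\prod_k G k).@[z] * \sum_k grad (G k) z i / (G k).@[z].
Proof.
move=> G0; rewrite /grad; elim: (index_enum _) => [|k s IH].
  by rewrite !big_nil mulr0 -mpolyC1 mderivC meval0.
rewrite !big_cons mderivM mevalD !mevalM IH.
by field; apply: G0.
Qed.

End FaceLimits.

(** * Newton-admissible families *)

Section Admissible.
Variables (R : realType) (n k0 : nat) (F : 'I_k0 -> {mpoly {poly R[i]}[n]}).
Local Notation C := (R[i]).
Local Notation nm := (@Normc.normc R).
Local Notation fk k t := (fspec (F k) t).
Variables (R0 tau0 : R).
Hypothesis tau0_gt0 : 0 < tau0.
Hypothesis F_at0 : forall k (t : C), (fk k t).@[fun _ => 0] = 0.
Hypothesis dominates : forall k t t', nm t < tau0 -> nm t' < tau0 ->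
  newton_dominates (F k) t t'.
Hypothesis nondeg : forall t, nm t < tau0 -> forall S : {set 'I_k0}, S != set0 ->
  Defs.nondegenerate S (fun k => fk k t).
Hypothesis tame : forall t, nm t < tau0 -> forall S : {set 'I_k0}, S != set0 ->
  exists2 Rad : R, R0 < Rad & tame_radius S (fun k => fk k t) Rad.

Lemma exponent_bound : exists D, forall k al, al \in msupp (F k) ->
  forall i : 'I_n, (al i <= D)%N.
Proof.
exists (\max_k \max_(al <- msupp (F k)) \max_i al i)%N => k al alF i.
apply: leq_trans (leq_bigmax k).
apply: leq_trans (leq_bigmax_seq _ alF isT).
exact: (leq_bigmax i).
Qed.

(** [face_val] and [face_grad] are the limits given by [face_limits] for [f^k] and [z_i d_i f^k],
    each divided by the monomial of [be k]. *)
Definition face_val (w : 'I_n -> nat) (a : 'I_n -> C) t0 (be : 'I_k0 -> 'X_{1..n}) k : C :=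
  (face_fn w (fk k t0)).@[a] / mono a (be k).
Definition face_grad (w : 'I_n -> nat) (a : 'I_n -> C) t0 (be : 'I_k0 -> 'X_{1..n}) k i : C :=
  a i * grad (face_fn w (fk k t0)) a i / mono a (be k).

Lemma face_val_eq0 w a t0 be k : (forall i, a i != 0) ->
  face_val w a t0 be k = 0 -> (face_fn w (fk k t0)).@[a] = 0.
Proof.
move=> a0 /eqP; rewrite mulf_eq0 invr_eq0.
by rewrite (negbTE (mono_neq0 _ a0)) orbF => /eqP.
Qed.

(** * Limits of linear relations between differentials *)

Section Sequences.
Variable U : (nat -> Prop) -> Prop.
Hypothesis HU : nat_ultrafilter U.
Local Notation tends := (@tends R U).

(* The limit of the linear relations
   [\sum_(k in S) c m k * (z_i * d_i f^k) = rhs m i],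
   after division by the size [s m] of the coefficients
   [c m k * mono (z m) (be k)]. *)
Record leading_relation (S : {set 'I_k0}) t0 (t : nat -> C) (z : nat -> 'I_n -> C)
    (c : nat -> 'I_k0 -> C) (rhs : nat -> 'I_n -> C) (J : {set 'I_n}) w a
    (be : 'I_k0 -> 'X_{1..n}) (s : nat -> R) (b : 'I_k0 -> C) : Prop := LeadingRelation {
  lead_pos : forall m, 0 <= s m;
  lead_upos : U (fun m => 0 < s m);
  lead_neq0 : exists2 k, k \in S & b k != 0;
  lead_msupp : forall k, k \in S -> be k \in msupp (fk k t0);
  lead_supp : forall k, k \in S -> supported J (be k);
  lead_min : forall k, k \in S ->
    forall al, al \in msupp (fk k t0) -> (wdot w (be k) <= wdot w al)%N;
  lead_val : forall k, k \in S ->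
    tends (fun m => (fk k (t m)).@[z m] / mono (z m) (be k)) (face_val w a t0 be k);
  lead_grad : forall k i, k \in S ->
    tends (fun m => z m i * grad (fk k (t m)) (z m) i / mono (z m) (be k))
      (face_grad w a t0 be k i);
  lead_term : forall k, k \in S ->
    tends (fun m => c m k * (fk k (t m)).@[z m] / (s m)%:C%C) (b k * face_val w a t0 be k);
  lead_rhs : forall i, tends (fun m => rhs m i / (s m)%:C%C)
    (\sum_(k in S) b k * face_grad w a t0 be k i) }.

Lemma leading_relation_exists (S : {set 'I_k0}) t0 (t : nat -> C) (z : nat -> 'I_n -> C)
    (c : nat -> 'I_k0 -> C) (rhs : nat -> 'I_n -> C) (J : {set 'I_n}) D w a :
  adapted U J D z w a ->
  (forall k al, al \in msupp (F k) -> forall i : 'I_n, (al i <= D)%N) ->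
  tends t t0 -> nm t0 < tau0 ->
  (forall k, k \in S ->
    U (fun m => exists2 al, al \in msupp (fk k (t m)) & supported J al)) ->
  U (fun m => exists2 k, k \in S & c m k != 0) ->
  U (fun m => forall i,
    \sum_(k in S) c m k * (z m i * grad (fk k (t m)) (z m) i) = rhs m i) ->
  exists be s b, leading_relation S t0 t z c rhs J w a be s b.
Proof.
move=> had FD tt0 t0small supp cn rel.
have tsmall : U (fun m => nm (t m) < tau0).
  have d : 0 < tau0 - nm t0 by rewrite subr_gt0.
  apply: (ultra_mono HU) (tt0 _ d) => m h.
  have := le_lt_trans (nm_dist (t m) t0) h.
  by rewrite ltr_norml => /andP[_]; rewrite ltrD2r.
have dom k : U (fun m => newton_dominates (F k) (t m) t0).
  by apply: (ultra_mono HU) tsmall => m h; apply: dominates.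
have ex k : exists be : 'X_{1..n}, k \in S ->
    [/\ be \in msupp (fk k t0), supported J be,
        forall al, al \in msupp (fk k t0) -> (wdot w be <= wdot w al)%N,
        tends (fun m => (fk k (t m)).@[z m] / mono (z m) be)
          ((face_fn w (fk k t0)).@[a] / mono a be)
      & forall i, tends (fun m => z m i * grad (fk k (t m)) (z m) i / mono (z m) be)
          (a i * grad (face_fn w (fk k t0)) a i / mono a be)].
  case: (boolP (k \in S)) => [kS|_]; last by exists 0%MM.
  by have [be hbe] := face_limits HU had (FD k) tt0 (dom k) (supp k kS); exists be.
have [be hbe] := choice _ ex.
have m0 k : k \in S -> U (fun m => mono (z m) (be k) != 0).
  by move=> /hbe[_ beJ _ _ _]; apply: (adapted_mono_neq0 HU had).
have m0all : U (fun m => forall k, k \in S -> mono (z m) (be k) != 0).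
  apply: ultra_forall => // k; case: (boolP (k \in S)) => [kS|_].
    by apply: (ultra_mono HU) (m0 k kS).
  by apply: ultraW.
(* The monomial moves from the derivatives, which then converge, to the coefficients, which are then
   normalised. The value 0 outside [S] allows the normalisation to run over all indices. *)
pose bs k m := if k \in S then c m k * mono (z m) (be k) else 0.
have bsn : U (fun m => exists k, bs k m != 0).
  apply: (ultra_mono HU) (ultra_and HU cn m0all) => m [[k kS ck] /(_ k kS) mk].
  by exists k; rewrite /bs kS mulf_neq0.
have [upos [b [kb bn] blim]] := normalized_limits HU bsn.
pose s m := \sum_k nm (bs k m).
have b0 k : k \notin S -> b k = 0.
  move=> /negbTE kS; apply: (tends_uniq HU (blim k)).
  by apply: (tends_ext HU) (tends_cst HU 0) => m; rewrite /bs kS mul0r.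
exists be, s, b; split=> //.
- by move=> m; apply: sumr_ge0 => k _; apply: nm_ge0.
- by exists kb => //; apply: contraT => /b0 E; rewrite E eqxx in bn.
- by move=> k kS; have [] := hbe k kS.
- by move=> k kS; have [] := hbe k kS.
- by move=> k kS; have [] := hbe k kS.
- by move=> k kS; have [] := hbe k kS.
- by move=> k i kS; have [] := hbe k kS.
- move=> k kS; have [_ _ _ hval _] := hbe k kS.
  apply: (tends_eq HU) (tendsM HU (blim k) hval).
  apply: (ultra_mono HU) (m0 k kS) => m mk.
  rewrite /bs kS -/(s m); move: (s m)%:C%C => q.
  by rewrite -[RHS]mulr1 -(divff mk); ring.
- move=> i.
  have := @tends_sum _ _ HU _ (index_enum _) (fun k => k \in S)
    (fun k m => bs k m / (s m)%:C%C * (z m i * grad (fk k (t m)) (z m) i / mono (z m) (be k)))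
    (fun k => b k * face_grad w a t0 be k i).
  move=> h; apply: (tends_eq HU) (h _); last first.
    move=> k _ kS; apply: (tendsM HU (blim k)).
    by have [] := hbe k kS.
  apply: (ultra_mono HU) (ultra_and HU rel m0all) => m [<- mk].
  rewrite mulr_suml; apply: eq_bigr => k kS; rewrite /bs kS -/(s m).
  by rewrite -[RHS]mulr1 -(divff (mk k kS)); ring.
Qed.

Lemma leading_euler S t0 t z c rhs J w a be s b :
  leading_relation S t0 t z c rhs J w a be s b ->
  \sum_i (w i)%:R * (\sum_(k in S) b k * face_grad w a t0 be k i) =
  \sum_(k in S) (wdot w (be k))%:R * (b k * face_val w a t0 be k).
Proof.
move=> L; under eq_bigr do rewrite mulr_sumr.
rewrite exchange_big /=; apply: eq_bigr => k kS.
rewrite /face_val mulrCA [X in b k * X]mulrA.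
rewrite -(face_fn_euler a (lead_msupp L kS) (lead_min L kS)) mulr_suml mulr_sumr.
by apply: eq_bigr => i _; rewrite /face_grad; ring.
Qed.

End Sequences.

(** The factor [z_i] discards the coordinates that vanish at [z], so the relation lives on the torus
    of the nonzero ones, where no [f^k] with [k] in [S] is identically zero. For [kap = 0] the
    differentials are dependent along this stratum; for [kap > 0] the stratum's intersection with
    the [V(f^k)] is tangent to the sphere through [z]. *)
Definition bad_stratum t (z : 'I_n -> C) (S : {set 'I_k0}) (c : 'I_k0 -> C) (kap : R) :=
  [/\ forall k, k \in S -> (fk k t).@[z] = 0,
      forall k, k \in S ->
        exists2 al, al \in msupp (fk k t) & forall i, al i != 0%N -> z i != 0,
      exists2 k, k \in S & c k != 0, 0 <= kap
    & forall i, \sum_(k in S) c k * (z i * grad (fk k t) z i) =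
        kap%:C%C * (z i * conjc (z i))].

Lemma mul_conjc (x : C) : x * conjc x = (nm x ^+ 2)%:C%C.
Proof.
case: x => x y /=; rewrite sqr_sqrtr ?addr_ge0 ?sqr_ge0 //.
by apply/eqP; rewrite eq_complex /=; apply/andP; split; apply/eqP; ring.
Qed.

(** Along bad points shrinking to the origin all weights are positive. The right-hand sides
    [kap |z_i|^2 / s] have a nonnegative limit vector, whose [w]-weighted sum is 0 by Euler's
    identity because the [f^k] vanish along the sequence. This vector is therefore zero, and
    nondegeneracy at [t = 0] is contradicted. *)
Lemma strata_transverse : exists2 rho : R, 0 < rho &
  forall t z S c kap, nm t <= rho -> (forall i, nm (z i) <= rho) ->
    ~ bad_stratum t z S c kap.
Proof.
apply: NNPP => no.
have [U HU] := nat_ultrafilter_exists.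
have ex m : exists p : C * ('I_n -> C) * {set 'I_k0} * ('I_k0 -> C) * R,
    let: (t, z, T, c, kap) := p in
    [/\ nm t <= m.+1%:R^-1, forall i, nm (z i) <= m.+1%:R^-1 & bad_stratum t z T c kap].
  apply: NNPP => h; apply: no; exists m.+1%:R^-1; first by rewrite invr_gt0 ltr0n.
  by move=> t z S c kap ht hz bad; apply: h; exists (t, z, S, c, kap).
have [p hp] := choice _ ex.
pose t m := (p m).1.1.1.1; pose z m := (p m).1.1.1.2.
pose Sm m := (p m).1.1.2; pose c m := (p m).1.2; pose kap m := (p m).2.
have {hp} [ht hz bad] : [/\ forall m, nm (t m) <= m.+1%:R^-1,
    forall m i, nm (z m i) <= m.+1%:R^-1 &
    forall m, bad_stratum (t m) (z m) (Sm m) (c m) (kap m)].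
  by split=> m; have := hp m; rewrite /t /z /Sm /c /kap;
     case: (p m) => [[[[? ?] ?] ?] ?] [].
have [S hS] : exists S, U (fun m => Sm m = S).
  by apply: (ultra_pick HU); apply: ultraW => // m; exists (Sm m).
have [J hJ] : exists J : {set 'I_n}, U (fun m => [set i | z m i != 0] = J).
  by apply: (ultra_pick HU); apply: ultraW => // m; exists [set i | z m i != 0].
have zJ : U (fun m => forall i, (z m i != 0) = (i \in J)).
  by apply: (ultra_mono HU) hJ => m <- i; rewrite inE.
have zB i : U (fun m => nm (z m i) <= 1).
  by apply: ultraW => // m; apply: (le_trans (hz m i)); rewrite invf_le1 ?ler1n ?ltr0n.
have [D FD] := exponent_bound.
have [w [a had]] := adapted_exists HU D zJ zB.
have w0 i : (0 < w i)%N.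
  rewrite lt0n; apply/negP => /eqP /(adapted_lim had) h.
  have := adapted_neq0 had i.
  by rewrite (tends_uniq HU h (small_tends0 HU (hz^~ i))) eqxx.
have t0small : nm (0 : C) < tau0 by rewrite Normc.normc0.
pose rhs m i := (kap m)%:C%C * (z m i * conjc (z m i)).
have [be [s [b L]]] : exists be s b, leading_relation U S 0 t z c rhs J w a be s b.
  apply: (leading_relation_exists HU had FD (small_tends0 HU ht) t0small).
  - move=> k kS; apply: (ultra_mono HU) (ultra_and HU hS zJ) => m [Sm_S zm].
    have [_ /(_ k) h _ _ _] := bad m; rewrite Sm_S in h.
    have [al alF hal] := h kS; exists al => // i; rewrite -zm => hi.
    by apply/eqP; apply: contraT => /hal; rewrite (negbTE hi).
  - by apply: (ultra_mono HU) hS => m <-; have [] := bad m.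
  - by apply: (ultra_mono HU) hS => m <-; have [] := bad m.
have val0 k : k \in S -> face_val w a 0 be k = 0.
  move=> kS; apply: (tends_uniq HU (lead_val L kS)).
  apply: (tends_eq HU) (tends_cst HU 0); apply: (ultra_mono HU) hS => m Sm_S.
  by have [/(_ k) h _ _ _ _] := bad m; rewrite h ?mul0r // Sm_S.
have rhs_ge0 i : exists2 r : R, 0 <= r &
    \sum_(k in S) b k * face_grad w a 0 be k i = r%:C%C.
  apply: (tends_ge0 HU _ (lead_rhs L i)) => m.
  exists (kap m * nm (z m i) ^+ 2 / s m).
    rewrite divr_ge0 ?(lead_pos L) // mulr_ge0 ?sqr_ge0 //.
    by have [] := bad m.
  by rewrite /rhs mul_conjc -rmorphM -fmorph_div.
have [r r0 rE] : exists2 r : 'I_n -> R, forall i, 0 <= r i &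
    forall i, \sum_(k in S) b k * face_grad w a 0 be k i = (r i)%:C%C.
  have [r hr] := choice (fun i (x : R) => 0 <= x /\
    \sum_(k in S) b k * face_grad w a 0 be k i = x%:C%C)
    (fun i => let: ex_intro2 x h1 h2 := rhs_ge0 i in ex_intro _ x (conj h1 h2)).
  by exists r => i; have [] := hr i.
have := leading_euler L.
rewrite [RHS]big1 => [|k kS]; last by rewrite val0 // !mulr0.
under eq_bigr do rewrite rE -[_%:R](rmorph_nat (@real_complex R)) -rmorphM.
rewrite -rmorph_sum => /eqP; rewrite fmorph_eq0 psumr_eq0; last first.
  by move=> i _; rewrite mulr_ge0 ?ler0n.
move=> /allP sum0.
have ri0 i : r i = 0.
  have := sum0 i (mem_index_enum i).
  by rewrite /= mulf_eq0 pnatr_eq0 eqn0Ngt w0 /= => /eqP.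
have [k kS bk] := lead_neq0 L.
have Sn : S != set0 by apply/set0Pn; exists k.
have fz k' : k' \in S -> (face_fn w (fk k' 0)).@[a] = 0.
  by move=> /val0; apply: face_val_eq0; apply: (adapted_neq0 had).
have li := nondeg t0small Sn w0 (adapted_neq0 had) fz.
have := lin_indep_scaled li (adapted_neq0 had)
  (fun k' => mono_neq0 (be k') (adapted_neq0 had)) (b := b) _ kS.
move=> h; move: bk; rewrite h ?eqxx // => i _.
by apply: (etrans (rE i)); rewrite ri0.
Qed.

(** * Critical points of the product near the origin *)

Lemma eval_neq0_msupp (g : {mpoly C[n]}) (z : 'I_n -> C) : g.@[z] != 0 ->
  exists2 al, al \in msupp g & forall i, al i != 0%N -> z i != 0.
Proof.
move=> gz; apply: NNPP => no; move/negP: gz; apply.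
rewrite mevalE big_seq big1 // => al alg.
case: (classic (exists2 i, al i != 0%N & z i = 0)) => [[i ali zi]|h].
  by rewrite [X in _ * X](mono_eq0 zi ali) mulr0.
by case: no; exists al => // i ali; apply/eqP => zi; apply: h; exists i.
Qed.

Lemma prod_evalE t (z : 'I_n -> C) : (\prod_k fk k t).@[z] = \prod_k (fk k t).@[z].
Proof. by rewrite rmorph_prod. Qed.

Lemma prod_neq0 t (z : 'I_n -> C) : (\prod_k fk k t).@[z] != 0 ->
  forall k, (fk k t).@[z] != 0.
Proof. by rewrite prod_evalE => /prodf_neq0 h k; apply: h. Qed.

(** Logarithmic differentiation, with coefficients chosen so that their products with the [f^k] all
    equal [lam f]; [sequence_setup] turns this coincidence into the common limit [e]. *)
Lemma prod_gradE t (z : 'I_n -> C) lam i : (\prod_k fk k t).@[z] != 0 ->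
  \sum_(k in [set: 'I_k0]) lam * (\prod_k fk k t).@[z] / (fk k t).@[z] *
    (z i * grad (fk k t) z i) = lam * (z i * grad (\prod_k fk k t) z i).
Proof.
move=> /prod_neq0 f0; rewrite grad_prod //; move: (\prod_j _).@[z] => p; rewrite !mulr_sumr.
apply: eq_big => [k|k _]; first by rewrite inE.
move: (f0 k); move: (fk k t).@[z] (grad (fk k t) z i) => x y x0.
by field.
Qed.

Lemma sequence_setup U (HU : nat_ultrafilter U) (t : nat -> C) (z : nat -> 'I_n -> C)
    t0 (B : R) (lam : nat -> C) :
  (0 < k0)%N ->
  tends U t t0 -> nm t0 < tau0 -> (forall i, U (fun m => nm (z m i) <= B)) ->
  (forall m, (\prod_k fk k (t m)).@[z m] != 0) -> (forall m, lam m != 0) ->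
  exists J D w a be s b, adapted U J D z w a /\
   (leading_relation U [set: 'I_k0] t0 t z
     (fun m k => lam m * (\prod_k fk k (t m)).@[z m] / (fk k (t m)).@[z m])
     (fun m i => lam m * (z m i * grad (\prod_k fk k (t m)) (z m) i)) J w a be s b /\
   exists e, forall k, b k * face_val w a t0 be k = e).
Proof.
move=> k0_gt0 tt0 t0s zB f0 lam0.
have [J hJ] : exists J : {set 'I_n}, U (fun m => [set i | z m i != 0] = J).
  by apply: (ultra_pick HU); apply: ultraW => // m; exists [set i | z m i != 0].
have zJ : U (fun m => forall i, (z m i != 0) = (i \in J)).
  by apply: (ultra_mono HU) hJ => m <- i; rewrite inE.
have [D FD] := exponent_bound.
have [w [a had]] := adapted_exists HU D zJ zB.
have [|||be [s [b L]]] := leading_relation_exists HU (S := [set: 'I_k0])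
  (c := fun m k => lam m * (\prod_k fk k (t m)).@[z m] / (fk k (t m)).@[z m])
  (rhs := fun m i => lam m * (z m i * grad (\prod_k fk k (t m)) (z m) i)) had FD tt0 t0s.
- move=> k _; apply: (ultra_mono HU) zJ => m zm.
  have [al alF hal] := eval_neq0_msupp (prod_neq0 (f0 m) k).
  exists al => // i; rewrite -zm => hi.
  by apply/eqP; apply: contraT => /hal; rewrite (negbTE hi).
- apply: ultraW => // m; exists (Ordinal k0_gt0); first by rewrite inE.
  by rewrite !mulf_neq0 ?invr_eq0 ?(prod_neq0 (f0 m)).
- by apply: ultraW => // m i; rewrite prod_gradE.
exists J, D, w, a, be, s, b; split=> //; split=> //.
exists (b (Ordinal k0_gt0) * face_val w a t0 be (Ordinal k0_gt0)) => k.
apply: (tends_uniq HU (lead_term L (in_setT k))).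
apply: (tends_ext HU _ (lead_term L (in_setT (Ordinal k0_gt0)))) => m.
have q j : lam m * (\prod_k fk k (t m)).@[z m] / (fk j (t m)).@[z m] *
    (fk j (t m)).@[z m] = lam m * (\prod_k fk k (t m)).@[z m].
  by apply: divfK; apply: (prod_neq0 (f0 m)).
exact: (congr1 (fun x => x / (s m)%:C%C) (etrans (q _) (esym (q k)))).
Qed.

Lemma meval_at0 (g : {mpoly C[n]}) : g.@[fun=> 0] = g@_0%MM.
Proof.
rewrite mevalE [in RHS](mpolyE g) raddf_sum /=; apply: eq_bigr => al _.
rewrite mcoeffZ mcoeffX; congr (_ * _).
case: eqP => [->|al0]; first by rewrite big1 // => i _; rewrite mnm0E expr0.
apply/eqP/prodf_eq0; apply: NNPP => no; apply: al0; apply/mnmP => i; rewrite mnm0E.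
apply/eqP; apply: contraT => ali; case: no; exists i => //.
by rewrite expr0n (negbTE ali) eqxx.
Qed.

(** At critical points the right-hand sides are 0, so Euler's identity reads
    [e * sum_k d(w; f^k) = 0]. Each degree is positive, since [f^k] has no constant term and all
    weights are positive. Hence [e = 0], and nondegeneracy applies to the [k] with [b k] nonzero. *)
Lemma no_critical_point : (0 < k0)%N -> exists2 rho : R, 0 < rho &
  forall t z, nm t <= rho -> (forall i, nm (z i) <= rho) ->
    (\prod_k fk k t).@[z] != 0 -> ~ forall i, grad (\prod_k fk k t) z i = 0.
Proof.
move=> k0_gt0; apply: NNPP => no.
have [U HU] := nat_ultrafilter_exists.
have ex m : exists p : C * ('I_n -> C),
    [/\ nm p.1 <= m.+1%:R^-1, forall i, nm (p.2 i) <= m.+1%:R^-1,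
        (\prod_k fk k p.1).@[p.2] != 0 & forall i, grad (\prod_k fk k p.1) p.2 i = 0].
  apply: NNPP => h; apply: no; exists m.+1%:R^-1; first by rewrite invr_gt0 ltr0n.
  by move=> t z ht hz fz g0; apply: h; exists (t, z).
have [p hp] := choice _ ex.
pose t m := (p m).1; pose z m := (p m).2.
have t0 : tends U t 0 by apply: (small_tends0 HU) => // m; have [] := hp m.
have z0 i : tends U (fun m => z m i) 0.
  by apply: (small_tends0 HU) => // m; have [_ h _ _] := hp m; apply: h.
have zB i : U (fun m => nm (z m i) <= 1).
  apply: (ultra_mono HU) (tends_nm_bound HU (z0 i)) => m.
  by rewrite Normc.normc0 add0r.
have t0s : nm (0 : C) < tau0 by rewrite Normc.normc0.
have f0 m : (\prod_k fk k (t m)).@[z m] != 0 by have [] := hp m.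
have [J [D [w [a [be [s [b [had [L [e hE]]]]]]]]]] :=
  sequence_setup HU k0_gt0 t0 t0s zB f0 (fun=> oner_neq0 _).
have a0 := adapted_neq0 had.
have w0 i : (0 < w i)%N.
  rewrite lt0n; apply/negP => /eqP /(adapted_lim had) h.
  by have := a0 i; rewrite (tends_uniq HU h (z0 i)) eqxx.
have rhs0 i : \sum_(k in [set: 'I_k0]) b k * face_grad w a 0 be k i = 0.
  apply: (tends_uniq HU (lead_rhs L i)); apply: (tends_ext HU) (tends_cst HU 0) => m.
  by have [_ _ _ g0] := hp m; rewrite g0 !mulr0 mul0r.
have d0 k : wdot w (be k) != 0%N.
  rewrite /wdot sum_nat_eq0; apply/negP => /forallP be0.
  have E : be k = 0%MM.
    apply/mnmP => i; rewrite mnm0E; have := be0 i.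
    by rewrite /= muln_eq0 eqn0Ngt w0 /= => /eqP.
  have := lead_msupp L (in_setT k).
  by rewrite E mcoeff_msupp -meval_at0 F_at0 eqxx.
have e0 : e = 0.
  have := leading_euler L; rewrite big1 => [|i _]; last by rewrite rhs0 mulr0.
  under eq_bigr do rewrite hE.
  rewrite -mulr_suml -natr_sum => /esym/eqP; rewrite mulf_eq0 pnatr_eq0 sum_nat_eq0.
  move=> /orP[/forallP /(_ (Ordinal k0_gt0))|/eqP//].
  by rewrite inE (negbTE (d0 _)).
pose S := [set k | b k != 0].
have [k _ bk] := lead_neq0 L.
have kS : k \in S by rewrite inE.
have Sn : S != set0 by apply/set0Pn; exists k.
have fz k' : k' \in S -> (face_fn w (fk k' 0)).@[a] = 0.
  rewrite inE => bk'; apply: (@face_val_eq0 _ _ _ be) => //.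
  by have /eqP := hE k'; rewrite e0 mulf_eq0 (negbTE bk') => /eqP.
have li := nondeg t0s Sn w0 a0 fz.
have := lin_indep_scaled li a0 (fun k' => mono_neq0 (be k') a0) (b := b) _ kS.
move=> h; move: bk; rewrite h ?eqxx // => i _.
rewrite -[RHS](rhs0 i) [RHS](bigID (mem S)) /= [X in _ = _ + X]big1 ?addr0.
  by apply: eq_bigl => j; rewrite in_setT.
by move=> j; rewrite !inE negbK => /eqP ->; rewrite mul0r.
Qed.

(** * Tangency to spheres away from the origin *)

Lemma face_grad_eq0 w a t0 (be : 'I_k0 -> 'X_{1..n}) k i :
  be k \in msupp (fk k t0) ->
  (forall al, al \in msupp (fk k t0) -> (wdot w (be k) <= wdot w al)%N) ->
  wdot w (be k) = 0%N -> w i != 0%N -> face_grad w a t0 be k i = 0.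
Proof.
move=> beF bemin d0 wi; rewrite /face_grad (face_fnE beF bemin) sumX_grad big1 ?mul0r //.
move=> al; rewrite d0 sum_nat_eq0 => /forallP /(_ i).
by rewrite /= muln_eq0 (negbTE wi) /= => /eqP ->; rewrite !mul0r.
Qed.

Lemma normv_sqr (z : 'I_n -> C) : normv z ^+ 2 = \sum_i nm (z i) ^+ 2.
Proof. by rewrite sqr_sqrtr // sumr_ge0 // => i _; rewrite sqr_ge0. Qed.

Lemma normv_ge0 (z : 'I_n -> C) : 0 <= normv z.
Proof. exact: sqrtr_ge0. Qed.

Lemma nm_le_normv (z : 'I_n -> C) i : nm (z i) <= normv z.
Proof.
rewrite -(@ler_pXn2r _ 2) ?nnegrE ?nm_ge0 ?normv_ge0 // normv_sqr (bigD1 i) //=.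
by rewrite lerDl sumr_ge0 // => j _; rewrite sqr_ge0.
Qed.

Lemma sum_mul_conjc (z : 'I_n -> C) : \sum_i z i * conjc (z i) = (normv z ^+ 2)%:C%C.
Proof.
by rewrite normv_sqr rmorph_sum; apply: eq_bigr => i _; rewrite mul_conjc.
Qed.

Lemma normv_limit U (HU : nat_ultrafilter U) (z : nat -> 'I_n -> C) z0 (lo hi : R) :
  (forall i, tends U (fun m => z m i) (z0 i)) -> 0 <= lo -> 0 <= hi ->
  (forall m, lo <= normv (z m)) -> (forall m, normv (z m) <= hi) ->
  lo <= normv z0 <= hi.
Proof.
move=> zz0 lo0 hi0 hlo hhi.
have lim : tends U (fun m => (normv (z m) ^+ 2)%:C%C) (normv z0 ^+ 2)%:C%C.
  rewrite -sum_mul_conjc; have := @tends_sum _ _ HU _ (index_enum 'I_n) predT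
    (fun i m => z m i * conjc (z m i)) (fun i => z0 i * conjc (z0 i)).
  move=> h; apply: (tends_ext HU _ (h _)) => [m|i _ _]; first exact: sum_mul_conjc.
  by apply: tendsM => //; apply: tends_conj.
have nE (x : 'I_n -> C) : nm (normv x ^+ 2)%:C%C = normv x ^+ 2.
  by rewrite nm_real ger0_norm // sqr_ge0.
rewrite -(@ler_pXn2r _ 2 _ lo) ?nnegrE ?normv_ge0 //.
rewrite -(@ler_pXn2r _ 2 _ (normv z0)) ?nnegrE ?normv_ge0 //.
rewrite -nE; apply/andP; split.
  apply: (tends_nm_ge HU _ lim); apply: ultraW => // m.
  by rewrite nE ler_pXn2r ?nnegrE ?normv_ge0.
apply: (tends_nm_le HU _ lim); apply: ultraW => // m.
by rewrite nE ler_pXn2r ?nnegrE ?normv_ge0.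
Qed.

(** If no [delta] works, tangency points with [f] tending to 0 have a limit [z0] off the origin with
    [f_t0(z0) = 0], whose nonzero coordinates are exactly those of weight 0. The bounds on [rho] act
    at this limit: [rho < tau0] keeps [t0] admissible, [rho ^+ 2 < R0] puts [z0] within the radius
    of tameness, and [rho <= rho0] makes [nobad] applicable at [z0]. *)
Lemma no_tangency rho0 rho :
  (0 < k0)%N -> rho <= rho0 -> rho < tau0 -> 0 < rho -> rho ^+ 2 < R0 ->
  (forall t z S c kap, nm t <= rho0 -> (forall i, nm (z i) <= rho0) ->
    ~ bad_stratum t z S c kap) ->
  forall eps, 0 < eps -> exists2 delta : R, 0 < delta &
  forall t z lam, nm t <= rho -> eps <= normv z -> normv z <= rho ->
    (\prod_k fk k t).@[z] != 0 -> nm (\prod_k fk k t).@[z] <= delta ->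
    ~ forall i, conjc (z i) = lam * grad (\prod_k fk k t) z i.
Proof.
move=> k0_gt0 rho_rho0 rho_tau rho_gt0 rho_R0 nobad eps eps0.
apply: NNPP => no.
have [U HU] := nat_ultrafilter_exists.
have ex m : exists p : C * ('I_n -> C) * C,
    [/\ nm p.1.1 <= rho, eps <= normv p.1.2 /\ normv p.1.2 <= rho,
        (\prod_k fk k p.1.1).@[p.1.2] != 0,
        nm (\prod_k fk k p.1.1).@[p.1.2] <= m.+1%:R^-1 &
        forall i, conjc (p.1.2 i) = p.2 * grad (\prod_k fk k p.1.1) p.1.2 i].
  apply: NNPP => h; apply: no; exists m.+1%:R^-1; first by rewrite invr_gt0 ltr0n.
  by move=> t z lam ht h1 h2 fz fd g0; apply: h; exists (t, z, lam).
have [p hp] := choice _ ex.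
pose t m := (p m).1.1; pose z m := (p m).1.2; pose lam m := (p m).2.
have [t0 tt0] : exists t0, tends U t t0.
  by apply: (@ultralimit _ _ HU _ rho); apply: ultraW => // m; have [] := hp m.
have t0rho : nm t0 <= rho.
  by apply: (tends_nm_le HU _ tt0); apply: ultraW => // m; have [] := hp m.
have zrho m i : nm (z m i) <= rho.
  by have [_ [_ h] _ _ _] := hp m; apply: le_trans h; apply: nm_le_normv.
have [z0 zz0] : exists z0, forall i, tends U (fun m => z m i) (z0 i).
  apply: (choice (fun i l => tends U (fun m => z m i) l)) => i.
  by apply: (@ultralimit _ _ HU _ rho); apply: ultraW.
have /andP[z0lo z0hi] : eps <= normv z0 <= rho.
  apply: (normv_limit HU zz0); rewrite ?ltW // => m;
  by have [_ [h1 h2] _ _ _] := hp m.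
have f0 m : (\prod_k fk k (t m)).@[z m] != 0 by have [] := hp m.
have flim0 : tends U (fun m => (\prod_k fk k (t m)).@[z m]) 0.
  by apply: (small_tends0 HU) => // m; have [] := hp m.
have tan m i : lam m * grad (\prod_k fk k (t m)) (z m) i = conjc (z m i).
  by have [_ _ _ _ h] := hp m; rewrite -h.
have lam0 m : lam m != 0.
  apply/negP => /eqP l0; have [_ [h1 _] _ _ _] := hp m.
  have : normv (z m) ^+ 2 = 0.
    rewrite normv_sqr big1 // => i _; have := tan m i; rewrite l0 mul0r => /esym/eqP.
    by rewrite conjc_eq0 => /eqP ->; rewrite Normc.normc0 expr0n.
  move/eqP; rewrite sqrf_eq0 => /eqP E.
  by move: h1; rewrite -/(z m) E leNgt eps0.
have t0s : nm t0 < tau0 by apply: le_lt_trans rho_tau.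
have [J [D [w [a [be [s [b [had [L [e hE]]]]]]]]]] :=
  sequence_setup HU k0_gt0 tt0 t0s (fun i => ultraW HU (zrho^~ i)) f0 lam0.
have a0 := adapted_neq0 had.
have beF k := lead_msupp L (in_setT k).
have bemin k := lead_min L (in_setT k).
have z0a i : w i = 0%N -> z0 i = a i.
  by move=> wi; apply: (tends_uniq HU (zz0 i)); apply: (adapted_lim had).
have z00 i : w i != 0%N -> z0 i = 0.
  by move=> wi; apply: (tends_uniq HU (zz0 i)); apply: (adapted_lim0 had).
have [i0 wi0] : exists i, w i = 0%N.
  apply: NNPP => h; have : normv z0 ^+ 2 = 0.
    rewrite normv_sqr big1 // => i _; rewrite z00 ?Normc.normc0 ?expr0n //.
    by apply/eqP => wi; apply: h; exists i.
  move/eqP; rewrite sqrf_eq0 => /eqP E.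
  by move: z0lo; rewrite E leNgt eps0.
pose l i := \sum_(k in [set: 'I_k0]) b k * face_grad w a t0 be k i.
have llim i : tends U (fun m => (z m i * conjc (z m i)) / (s m)%:C%C) (l i).
  by apply: (tends_ext HU _ (lead_rhs L i)) => m; rewrite mulrCA tan.
have zzlim i : tends U (fun m => z m i * conjc (z m i)) (z0 i * conjc (z0 i)).
  by apply: tendsM => //; apply: tends_conj.
have zz0n : z0 i0 * conjc (z0 i0) != 0.
  by rewrite mulf_neq0 ?conjc_eq0 // z0a.
(* At a coordinate of weight 0, [|z_i|^2] has a nonzero limit, so the convergence of [|z_i|^2 / s]
   forces that of [1 / s]; its limit is the multiplier [kap]. *)
have kaplim : tends U (fun m => ((s m)^-1)%:C%C) (l i0 / (z0 i0 * conjc (z0 i0))).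
  apply: (tends_eq HU) (tendsM HU (llim i0) (tendsV HU (zzlim i0) zz0n)).
  apply: (ultra_mono HU) (adapted_supp had) => m hm.
  have zi : z m i0 != 0.
    by rewrite hm; apply: contraT => /(adapted_out had); rewrite wi0.
  have zzi : z m i0 * conjc (z m i0) != 0 by rewrite mulf_neq0 ?conjc_eq0.
  by rewrite mulrAC divff // mul1r fmorphV.
have [kap kap0 kapE] : exists2 r : R, 0 <= r & l i0 / (z0 i0 * conjc (z0 i0)) = r%:C%C.
  apply: (tends_ge0 HU _ kaplim) => m; exists (s m)^-1 => //.
  by rewrite invr_ge0 (lead_pos L).
have lE i : l i = kap%:C%C * (z0 i * conjc (z0 i)).
  rewrite -kapE; apply: (tends_uniq HU (llim i)).
  apply: (tends_ext HU _ (tendsM HU kaplim (zzlim i))) => m.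
  by rewrite fmorphV mulrC.
have l0 i : w i != 0%N -> l i = 0.
  by move=> wi; rewrite lE z00 // mul0r mulr0.
have supp0 k i : wdot w (be k) = 0%N -> be k i != 0%N -> w i = 0%N.
  move=> /eqP; rewrite sum_nat_eq0 => /forallP /(_ i) /=.
  by rewrite muln_eq0 => /orP[/eqP|/eqP ->].
have monoa k : wdot w (be k) = 0%N -> mono z0 (be k) = mono a (be k).
  by move=> d0; apply: mono_eq => i /(supp0 k i d0)/z0a.
have monolim k : tends U (fun m => mono (z m) (be k)) (mono z0 (be k)).
  by apply: tends_prod => // i; apply: tendsX.
have mono0 k : U (fun m => mono (z m) (be k) != 0).
  by apply: (adapted_mono_neq0 HU had); apply: (lead_supp L (in_setT k)).
have flim k : tends U (fun m => (fk k (t m)).@[z m]) (fk k t0).@[z0].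
  rewrite fspec_evalE.
  apply: (tends_ext HU _ (tends_fspec_sum HU (F k) (fun=> 1) tt0 zz0)) => m.
  by rewrite fspec_evalE.
have glim k i : tends U (fun m => z m i * grad (fk k (t m)) (z m) i)
    (z0 i * grad (fk k t0) z0 i).
  rewrite fspec_gradE.
  apply: (tends_ext HU _ (tends_fspec_sum HU (F k) (fun al => (al i)%:R) tt0 zz0)) => m.
  by rewrite fspec_gradE.
(* For a face function of degree 0 the dividing monomial has a nonzero limit, so the limit data at
   [a] recover [f^k] and its derivatives at [z0] itself. *)
have fz0 k : wdot w (be k) = 0%N ->
    (fk k t0).@[z0] = face_val w a t0 be k * mono a (be k).
  move=> d0; rewrite -monoa //; apply: (tends_uniq HU (flim k)).
  apply: (tends_eq HU) (tendsM HU (lead_val L (in_setT k)) (monolim k)).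
  by apply: (ultra_mono HU) (mono0 k) => m mk; rewrite divfK.
have gz0 k i : wdot w (be k) = 0%N ->
    z0 i * grad (fk k t0) z0 i = face_grad w a t0 be k i * mono a (be k).
  move=> d0; rewrite -monoa //; apply: (tends_uniq HU (glim k i)).
  apply: (tends_eq HU) (tendsM HU (lead_grad L i (in_setT k)) (monolim k)).
  by apply: (ultra_mono HU) (mono0 k) => m mk; rewrite divfK.
(* Each product [w i * l i] is 0, so by Euler's identity either [e = 0] or all degrees are 0. In the
   latter case each [f^k(z0)] is a nonzero multiple of its face value, and [f(z0) = 0] makes one of
   these values vanish, hence [e] too. *)
have e0 : e = 0.
  have := leading_euler L; rewrite big1 => [|i _]; last first.
    case: (altP (w i =P 0%N)) => [->|wi]; first by rewrite mul0r.
    by rewrite -/(l i) l0 // mulr0.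
  under eq_bigr do rewrite hE.
  rewrite -mulr_suml -natr_sum => /esym/eqP; rewrite mulf_eq0 pnatr_eq0 sum_nat_eq0.
  move=> /orP[/forallP d0|/eqP//].
  have : \prod_k (fk k t0).@[z0] = 0.
    apply: (tends_uniq HU _ flim0).
    by apply: (tends_ext HU _ (tends_prod HU flim)) => m; rewrite prod_evalE.
  move/eqP/prodf_eq0 => [k _].
  have dk : wdot w (be k) = 0%N by have := d0 k; rewrite inE => /eqP.
  by rewrite fz0 // mulf_eq0 (negbTE (mono_neq0 _ a0)) orbF -(hE k) => /eqP ->; rewrite mulr0.
pose S := [set k | b k != 0].
have [k1 _ bk1] := lead_neq0 L.
have val0 k : k \in S -> face_val w a t0 be k = 0.
  rewrite inE => bk; have /eqP := hE k.
  by rewrite e0 mulf_eq0 (negbTE bk) => /eqP.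
(* Face functions of degree 0 involve no variable of positive weight, so the relation in the normal
   directions only sees [S2]. Its members vanish identically on the coordinate subspace of the
   weight-0 variables, which is what tameness requires. *)
pose S2 := [set k in S | wdot w (be k) != 0%N].
have S2sum i : w i != 0%N -> \sum_(k in S2) b k * face_grad w a t0 be k i = 0.
  move=> wi; rewrite -[RHS](l0 i wi) /l [RHS](bigID (mem S2)) /= [X in _ = _ + X]big1 ?addr0.
    by apply: eq_bigl => j; rewrite in_setT.
  move=> k; rewrite !inE /= negb_and !negbK => /orP[/eqP ->|/eqP d0].
    by rewrite mul0r.
  by rewrite (face_grad_eq0 _ (beF k) (bemin k) d0 wi) mulr0.
have S2empty : S2 = set0.
  apply/eqP; apply: contraT => S2n.
  have [k kS2] := set0Pn _ S2n; have kS2' := kS2.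
  move: kS2'; rewrite inE => /andP[kS dk].
  have [Rad RadR tr] := tame t0s S2n.
  pose I := [set i | w i == 0%N].
  have li : lin_indep S2 (fun i => i \notin I) (fun k => grad (face_fn w (fk k t0)) a).
    apply: (tr I _ _ w _ _ a) => //.
    - by apply/set0Pn; exists i0; rewrite inE wi0.
    - move=> k'; rewrite inE => /andP[_ dk'] y hy; rewrite mevalE big_seq big1 //.
      move=> al alF; have : wdot w al != 0%N.
        by rewrite -lt0n; apply: leq_trans (bemin k' al alF); rewrite lt0n.
      move=> /wdot_neq0[i wi ali].
      by rewrite [X in _ * X](@mono_eq0 _ _ y al i) ?mulr0 // hy // inE.
    - by have [i wi _] := wdot_neq0 dk; exists i.
    - by move=> i; rewrite inE.
    - apply: le_lt_trans (lt_trans rho_R0 RadR).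
      rewrite -(@ler_pXn2r _ 2) ?nnegrE ?normv_ge0 ?(ltW rho_gt0) // in z0hi.
      apply: le_trans z0hi; rewrite normv_sqr [leRHS](bigID (mem I)) /=.
      rewrite -[leLHS]addr0 lerD //.
        by apply: ler_sum => i; rewrite inE => /eqP wi; rewrite z0a.
      by rewrite sumr_ge0 // => i _; rewrite sqr_ge0.
    - by move=> k'; rewrite inE => /andP[/val0 h _]; apply: face_val_eq0 h.
  have := lin_indep_scaled li a0 (fun k' => mono_neq0 (be k') a0) (b := b) _ kS2.
  move=> h; move: kS; rewrite inE h ?eqxx // => i; rewrite inE => wi.
  exact: S2sum.
have dS k : k \in S -> wdot w (be k) = 0%N.
  move=> kS; apply/eqP; apply: contraT => dk.
  by have : k \in S2; [rewrite inE kS | rewrite S2empty inE].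
(* All remaining degrees are 0, so the limit relation is one between the differentials at [z0];
   dividing [b k] by the monomial at [a] undoes the normalisation of [face_grad]. *)
apply: (nobad t0 z0 S (fun k => b k / mono a (be k)) kap).
- exact: le_trans t0rho rho_rho0.
- by move=> i; apply: le_trans (nm_le_normv z0 i) (le_trans z0hi rho_rho0).
split=> //.
- by move=> k kS; rewrite fz0 ?dS // val0 // mul0r.
- move=> k kS; exists (be k) => // i /(supp0 k i (dS k kS)) wi.
  by rewrite z0a.
- by exists k1; rewrite ?inE // mulf_neq0 ?invr_eq0 // mono_neq0.
- move=> i; rewrite -lE /l [RHS](bigID (mem S)) /= [X in _ = _ + X]big1 ?addr0.
    rewrite [RHS](eq_bigl (mem S)); last by move=> k; rewrite in_setT.
    apply: eq_bigr => k kS; rewrite gz0 ?dS // mulrCA mulrC -mulrA.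
    by rewrite [_ / _ * _]mulrC mulrA; field; apply: mono_neq0.
  by move=> k; rewrite !inE negbK => /eqP ->; rewrite mul0r.
Qed.

End Admissible.

(* The vectors [g_j e_i - g_i e_j] span the kernel of [dg]; if [conj z] is
   orthogonal to all of them, it is a multiple of the gradient. *)
Lemma transverse_or_multiple (R : realType) n (g : {mpoly R[i][n]}) (z : 'I_n -> R[i]) j :
  grad g z j != 0 ->
  transverse_sphere_at g z \/ exists lam, forall i, conjc (z i) = lam * grad g z i.
Proof.
move=> gj; case: (classic (exists i, grad g z j * conjc (z i) - grad g z i * conjc (z j) != 0)).
  move=> [i p0]; left; split; first by exists j.
  set p := _ - _ in p0 => v.
  pose a0 k := grad g z j *+ (k == i) - grad g z i *+ (k == j).
  have sum_a0 (y : 'I_n -> R[i]) :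
      \sum_k a0 k * y k = grad g z j * y i - grad g z i * y j.
    have pick (x : R[i]) l : \sum_k x *+ (k == l) * y k = x * y l.
      rewrite (bigD1 l) //= eqxx mulr1n big1 ?addr0 // => k /negbTE ->.
      by rewrite mulr0n mul0r.
    under eq_bigr do rewrite mulrBl.
    by rewrite sumrB !pick.
  pose q := \sum_k v k * conjc (z k).
  exists (fun k => q / p * a0 k), (fun k => v k - q / p * a0 k); split.
  - by move=> k; rewrite addrC subrK.
  - under eq_bigr do rewrite mulrCA [grad g z _ * _]mulrC.
    by rewrite -mulr_sumr sum_a0 mulrC [X in X * _](_ : _ = 0) ?mul0r //; ring.
  - under eq_bigr do rewrite mulrBl -[_ * a0 _ * _]mulrA.
    by rewrite sumrB -mulr_sumr sum_a0 -/p -/q divfK // subrr.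
move=> no; right; exists (conjc (z j) / grad g z j) => i.
have /eqP : grad g z j * conjc (z i) - grad g z i * conjc (z j) = 0.
  by apply/eqP; apply: contraT => h; case: no; exists i.
by rewrite subr_eq0 => /eqP h; apply: (mulfI gj); rewrite h; field.
Qed.

(** * The uniform stable radius *)

Lemma grad_subC (R : realType) n (g : {mpoly R[i][n]}) eta z i :
  grad (g - eta%:MP) z i = grad g z i.
Proof. by rewrite /grad mderivB mderivC subr0. Qed.

Theorem theorem5p1 (R : realType) (n k0 : nat) (F : 'I_k0 -> {mpoly {poly R[i]}[n]}) :
  (0 < k0)%N ->
  (forall k, forall c : R[i], F k != (c%:P)%:MP) ->
  (forall k (t : R[i]), (fspec (F k) t).@[fun _ => 0] = 0) ->
  newton_admissible F ->
  let f_ := fun t : R[i] => \prod_(k < k0) fspec (F k) t in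
  exists2 tau : R, 0 < tau & exists2 r : R, 0 < r &
    forall eps eps' : R, 0 < eps' -> eps' <= eps -> eps <= r ->
    exists2 delta : R, 0 < delta &
      forall (eta t : R[i]), 0 < Normc.normc eta -> Normc.normc eta <= delta -> Normc.normc t <= tau ->
        nonsingular_in_ball (f_ t - eta%:MP) r /\
        forall eps'' : R, eps' <= eps'' -> eps'' <= eps ->
          transverse_to_sphere (f_ t - eta%:MP) eps''.
Proof.
move=> k0_gt0 _ F_at0 [R0 R0_gt0 [tau0 tau0_gt0 [gamma adm]]] f_.
have dom k t t' : Normc.normc t < tau0 -> Normc.normc t' < tau0 ->
    newton_dominates (F k) t t'.
  move=> ht ht'; apply: newton_boundary_weights => x.
  by apply: (proj1 (gamma k t t' ht ht' x)).
have nondeg t (ht : Normc.normc t < tau0) S Sn := proj1 (adm t ht S Sn).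
have tame t (ht : Normc.normc t < tau0) S Sn := proj2 (adm t ht S Sn).
have [rho0 rho0_gt0 nobad] := strata_transverse tau0_gt0 dom nondeg.
have [rho1 rho1_gt0 nocrit] := no_critical_point tau0_gt0 F_at0 dom nondeg k0_gt0.
have [rho [rho_gt0 le0 le1 [le_tau leR le_one]]] : exists rho : R,
    [/\ 0 < rho, rho <= rho0, rho <= rho1 & [/\ rho < tau0, rho < R0 & rho <= 1]].
  (* The halves provide the strict inequalities, and the bound 1 yields [rho ^+ 2 <= rho < R0]. *)
  exists (Num.min (Num.min rho0 rho1) (Num.min (Num.min (tau0 / 2) (R0 / 2)) 1)).
  have tau2 : tau0 / 2 < tau0 by lra.
  have R2 : R0 / 2 < R0 by lra.
  rewrite !lt_min !ge_min !gt_min rho0_gt0 rho1_gt0 tau2 R2 !lexx ltr01 !divr_gt0 //.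
  by rewrite !orbT.
have rho2 : rho ^+ 2 < R0.
  by apply: le_lt_trans leR; rewrite expr2 ler_piMl // ltW.
exists rho => //; exists rho => // eps eps' eps'_gt0 le_eps eps_rho.
(* [delta] depends on [eps'] only: tangencies are excluded in the whole shell [eps' <= |z| <= rho],
   which contains all the spheres considered. *)
have [delta delta_gt0 notan] := no_tangency dom tame k0_gt0 le0 le_tau
  rho_gt0 rho2 nobad eps'_gt0.
exists delta => // eta t eta_gt0 eta_le t_le.
have evalE z : (f_ t - eta%:MP).@[z] = 0 -> (f_ t).@[z] = eta.
  by rewrite mevalB mevalC => /eqP; rewrite subr_eq0 => /eqP.
have eta0 : eta != 0 by rewrite -nm_gt0.
have regular z : normv z <= rho -> (f_ t).@[z] = eta -> exists i, grad (f_ t) z i != 0.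
  move=> hz fz; apply: NNPP => no; apply: (nocrit t z).
  - exact: le_trans t_le le1.
  - by move=> i; apply: le_trans (nm_le_normv z i) (le_trans hz le1).
  - by rewrite -/(f_ t) fz.
  - by move=> i; apply/eqP; apply: contraT => h; case: no; exists i.
split.
  move=> z /ltW hz /evalE /(regular z hz)[i hi]; exists i.
  by rewrite grad_subC.
move=> e e1 e2 z ze /evalE fz.
have z_le : normv z <= rho by rewrite ze (le_trans e2).
have [j hj] := regular z z_le fz.
have gj : grad (f_ t - eta%:MP) z j != 0 by rewrite grad_subC.
have [tr|[lam hlam]] := transverse_or_multiple gj; first exact: tr.
case: (notan t z lam t_le _ z_le).
- by rewrite ze.
- by rewrite -/(f_ t) fz.
- by rewrite -/(f_ t) fz.
- by move=> i; rewrite hlam grad_subC.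
Qed.
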